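(* Let $\Lambda$ be a strongly connected row-finite $k$-graph with no sources and let $\omega\in Z^2(\Lambda,\mathbb{T})$. Let $c$ be the $1$-cocycle on the infinite-path groupoid $G_\Lambda$ given by $c(x,n,y)=\sum_{i=1}^k n_i\ln(\rho(A_i))$, and let $\sigma^c$ be the preferred dynamics on $\mathrm{C}^*(G_\Lambda;\tau_\omega)\cong\mathrm{C}^*(\Lambda;\omega)$, given by $\sigma^c_t(f)(x,n,y)=e^{itc(x,n,y)}f(x,n,y)$ for $f\in\mathrm{C_c}(G_\Lambda;\tau_\omega)$. Then the following hold. (1) If $\rho(A_i)=1$ for all $i=1,2,\dots,k$, then every state on $\mathrm{C}^*(\Lambda;\omega)$ is a $\sigma^c$-ground state on $\mathrm{C}^*(\Lambda;\omega)$. (2) If $\rho(A_i)\neq1$ for at least one $i$, then $\mathrm{C}^*(\Lambda;\omega)$ has no $\sigma^c$-ground states.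
   Context: $\mathbb{N}$ contains $0$. A $k$-graph is a countable category $\Lambda$ with a functor $d\colon\Lambda\to\mathbb{N}^k$ with the factorization property: if $d(\lambda)=m+n$ there are unique $\mu,\gamma\in\Lambda$ with $d(\mu)=m$, $d(\gamma)=n$, $s(\mu)=r(\gamma)$, $\lambda=\mu\gamma$. $\Lambda^p=d^{-1}(p)$; $\Lambda^0$ is the vertex set; $v\Lambda u=\{\lambda:r(\lambda)=v,s(\lambda)=u\}$, $v\Lambda^p=\{\lambda\in\Lambda^p:r(\lambda)=v\}$. $\Lambda$ is strongly connected if $v\Lambda u\neq\emptyset$ for all $u,v\in\Lambda^0$; has no sources if $v\Lambda^p\neq\emptyset$ for all $v,p$; is row-finite if $v\Lambda^p$ is finite for all $v,p$. For the standard basis $e_1,\dots,e_k$ of $\mathbb{N}^k$, $A_i\in\mathrm{M}_{\Lambda^0}$ is the matrix $A_i(v,u)=|v\Lambda^{e_i}u|$ and $\rho(A_i)$ is its spectral radius, understood to be defined and to lie in $(0,\infty)$ so that $c$ makes sense. $\Omega_k=\{(m,n)\in\mathbb{N}^k\times\mathbb{N}^k:m\le n\}$ is a $k$-graph with $r(p,q)=(p,p)$, $s(p,q)=(q,q)$, $(p,q)(q,n)=(p,n)$, $d(p,q)=q-p$. $\Lambda^\infty$ is the set of degree-preserving functors $x\colon\Omega_k\to\Lambda$, with $r(x)=x(0,0)$; $\kappa^l(x)(p,q)=x(p+l,q+l)$; for $\lambda\in\Lambda$ and $x\in\Lambda^\infty$ with $s(\lambda)=r(x)$, $\lambda x$ is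 the unique infinite path with initial segment $\lambda$ and $\kappa^{d(\lambda)}(\lambda x)=x$. The infinite-path groupoid is $G_\Lambda=\{(x,l,y)\in\Lambda^\infty\times\mathbb{Z}^k\times\Lambda^\infty: l=p-q,\ \kappa^p(x)=\kappa^q(y)\text{ for some }p,q\in\mathbb{N}^k\}$ with $r(x,l,y)=x$, $s(x,l,y)=y$, $(x,l,y)(y,l',z)=(x,l+l',z)$, $(x,l,y)^{-1}=(y,-l,x)$, and topology with basis $Z(\lambda,\mu)=\{(\lambda x,d(\lambda)-d(\mu),\mu x):x\in\Lambda^\infty,r(x)=s(\lambda)\}$ for $s(\lambda)=s(\mu)$. It is an étale groupoid. $Z^2(\Lambda,\mathbb{T})$ is the set of maps $\omega\colon\{(\lambda,\mu):s(\lambda)=r(\mu)\}\to\mathbb{T}$ with $\omega(r(\lambda),\lambda)=\omega(\lambda,s(\lambda))=1$ and $\omega(\lambda,\mu)\omega(\lambda\mu,\nu)=\omega(\lambda,\mu\nu)\omega(\mu,\nu)$. The twisted $k$-graph algebra $\mathrm{C}^*(\Lambda;\omega)$ is the universal $\mathrm{C}^*$-algebra generated by partial isometries $t_\lambda$, $\lambda\in\Lambda$, such that $\{t_v:v\in\Lambda^0\}$ are mutually orthogonal projections, $t_\lambda t_\mu=\omega(\lambda,\mu)t_{\lambda\mu}$ if $s(\lambda)=r(\mu)$, $t_\lambda^*t_\lambda=t_{s(\lambda)}$, and $t_v=\sum_{\lambda\in v\Lambda^n}t_\lambda t_\lambda^*$ for all $v\in\Lambda^0$, $n\in\mathbb{N}^k$.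 The groupoid cocycle $\tau_\omega$: fix $\mathcal{P}\subseteq\{(\lambda,\mu):s(\lambda)=s(\mu)\}$ containing all $(\lambda,s(\lambda))$ with $G_\Lambda=\bigsqcup_{(\lambda,\mu)\in\mathcal{P}}Z(\lambda,\mu)$. For $\alpha\in G_\Lambda$ let $(\lambda_\alpha,\mu_\alpha)\in\mathcal{P}$ be the unique pair with $\alpha\in Z(\lambda_\alpha,\mu_\alpha)$, and write $\mathrm{f}(x,n,y)=n$. For composable $\alpha,\beta$ there are $\nu,\xi,\zeta\in\Lambda$, $y\in\Lambda^\infty$ with $\mu_\alpha\nu=\lambda_\beta\xi$, $\lambda_\alpha\nu=\lambda_{\alpha\beta}\zeta$, $\mu_\beta\xi=\mu_{\alpha\beta}\zeta$, $\alpha=(\lambda_\alpha\nu y,\mathrm{f}(\alpha),\mu_\alpha\nu y)$, $\beta=(\lambda_\beta\xi y,\mathrm{f}(\beta),\mu_\beta\xi y)$, $\alpha\beta=(\lambda_{\alpha\beta}\zeta y,\mathrm{f}(\alpha\beta),\mu_{\alpha\beta}\zeta y)$, and $$\tau_\omega(\alpha,\beta)=\omega(\lambda_\alpha,\nu)\overline{\omega(\mu_\alpha,\nu)}\,\omega(\lambda_\beta,\xi)\overline{\omega(\mu_\beta,\xi)}\;\overline{\omega(\lambda_{\alpha\beta},\zeta)}\,\omega(\mu_{\alpha\beta},\zeta),$$ which is independent of the choices of $\nu,\xi,\zeta$ and is a continuous $2$-cocycle. $\mathrm{C}^*(G_\Lambda;\tau_\omega)$ is the full twisted groupoid $\mathrm{C}^*$-algebra,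 i.e. the enveloping $\mathrm{C}^*$-algebra of $\mathrm{C_c}(G_\Lambda;\tau_\omega)$ with $f*g(\gamma)=\sum_{r(\eta)=r(\gamma)}\tau_\omega(\eta,\eta^{-1}\gamma)f(\eta)g(\eta^{-1}\gamma)$, $f^*(\gamma)=\overline{\tau_\omega(\gamma,\gamma^{-1})f(\gamma^{-1})}$. By a theorem of Kumjian–Pask–Sims, $\mathrm{C}^*(\Lambda;\omega)\cong\mathrm{C}^*(G_\Lambda;\tau_\omega)$ via $t_\lambda\mapsto 1_{Z(\lambda,s(\lambda))}$; $\sigma^c$ is transported to $\mathrm{C}^*(\Lambda;\omega)$ through this isomorphism. A state $\psi$ is a $\sigma$-ground state if for every $a$ and every analytic element $b$ (one for which $t\mapsto\sigma_t(b)$ extends to an entire function) the function $z\mapsto\psi(a\sigma_z(b))$ is bounded on $\{\mathrm{Im}\,z\ge0\}$. *)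

(* Defs.v *)
From HB Require Import structures.
From mathcomp Require Import all_boot all_order all_algebra.
From mathcomp Require Import complex finmap.
From mathcomp Require Import all_classical all_reals all_analysis.

Set Implicit Arguments.
Unset Strict Implicit.
Unset Printing Implicit Defensive.

Import Order.TTheory GRing.Theory Num.Theory.
Import numFieldNormedType.Exports.

Local Open Scope classical_set_scope.
Local Open Scope complex_scope.
Local Open Scope ring_scope.

Notation NN k := {ffun 'I_k -> nat}.
Notation ZZ k := {ffun 'I_k -> int}.

Definition unitN k (i : 'I_k) : NN k := [ffun j => nat_of_bool (j == i)].
Definition leN k (m n : NN k) : bool := [forall i, (m i <= n i)%N].
Definition subN k (n m : NN k) : NN k := [ffun i => (n i - m i)%N].
Definition toZZ k (n : NN k) : ZZ k := [ffun i => (n i)%:Z].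

(* A countable category given by its morphisms, objects being identified with
   identity morphisms. [kcomp l m] is the composite when [ksrc l = krng m] and
   is unconstrained otherwise. *)
Record kgraph (k : nat) := KGraph {
  kmor :> countType;
  krng : kmor -> kmor;
  ksrc : kmor -> kmor;
  kcomp : kmor -> kmor -> kmor;
  kdeg : kmor -> NN k;
  krng_rng : forall l, krng (krng l) = krng l;
  ksrc_rng : forall l, ksrc (krng l) = krng l;
  krng_src : forall l, krng (ksrc l) = ksrc l;
  ksrc_src : forall l, ksrc (ksrc l) = ksrc l;
  krng_comp : forall l m, ksrc l = krng m -> krng (kcomp l m) = krng l;
  ksrc_comp : forall l m, ksrc l = krng m -> ksrc (kcomp l m) = ksrc m;
  kcomp_idl : forall l, kcomp (krng l) l = l;
  kcomp_idr : forall l, kcomp l (ksrc l) = l;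
  kcompA : forall l m n, ksrc l = krng m -> ksrc m = krng n ->
    kcomp l (kcomp m n) = kcomp (kcomp l m) n;
  kdeg_rng : forall l, kdeg (krng l) = 0;
  kdeg_src : forall l, kdeg (ksrc l) = 0;
  kdeg_comp : forall l m, ksrc l = krng m ->
    kdeg (kcomp l m) = kdeg l + kdeg m;
  kfactor : forall l m n, kdeg l = m + n ->
    exists! mg : kmor * kmor,
      [/\ kdeg mg.1 = m, kdeg mg.2 = n, ksrc mg.1 = krng mg.2
        & l = kcomp mg.1 mg.2]
}.

Section KGraphNotions.
Variables (k : nat) (L : kgraph k).

Definition vertex := {v : L | kdeg v == 0}.

Definition paths_from (v : L) (p : NN k) : set L :=
  [set l | krng l = v /\ kdeg l = p].
Definition paths_from_to (v : L) (p : NN k) (u : L) : set L :=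
  [set l | [/\ krng l = v, kdeg l = p & ksrc l = u]].

Definition strongly_connected : Prop :=
  forall u v : vertex, exists l : L, krng l = val v /\ ksrc l = val u.
Definition row_finite : Prop :=
  forall (v : vertex) (p : NN k), finite_set (paths_from (val v) p).
Definition no_sources : Prop :=
  forall (v : vertex) (p : NN k), paths_from (val v) p !=set0.

Definition vertex_matrix (i : 'I_k) (v u : vertex) : nat :=
  #|` fset_set (paths_from_to (val v) (unitN i) (val u))|.

End KGraphNotions.

Section SpectralRadius.
Variables (R : realType) (V : choiceType) (p : \bar R).

(* The l^p-norm of a function on V, for 1 <= p <= +oo. *)
Definition lp_norm (f : V -> R[i]) : \bar R :=
  if p is r%:E then ((\esum_(v in setT) (complex.Re `|f v| `^ r)%:E) `^ r^-1)%E
  else ereal_sup (range (fun v => (complex.Re `|f v|)%:E)).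

Definition lp_bounded (T : (V -> R[i]) -> V -> R[i]) : Prop :=
  exists M : R, forall f, (lp_norm f < +oo)%E ->
    (lp_norm (T f) <= M%:E * lp_norm f)%E.

(* The sum is finite when the rows of A have finite support. *)
Definition matrix_op (A : V -> V -> nat) (f : V -> R[i]) (v : V) : R[i] :=
  \sum_(u \in [set: V]) (A v u)%:R * f u.

Definition lp_resolvent_set (A : V -> V -> nat) : set R[i] :=
  [set z | exists2 S, lp_bounded S & forall f, (lp_norm f < +oo)%E ->
     S (fun v => matrix_op A f v - z * f v) = f /\
     (fun v => matrix_op A (S f) v - z * S f v) = f].

Definition lp_spectral_radius (A : V -> V -> nat) : \bar R :=
  ereal_sup [set (complex.Re `|z|)%:E | z in ~` lp_resolvent_set A].

(* For finite V this is the usual spectral radius for every p. For infinite V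
   the matrix must act boundedly on l^p(V) for its spectrum to make sense. *)
Definition is_spectral_radius (A : V -> V -> nat) (rho : R) : Prop :=
  lp_bounded (matrix_op A) /\ lp_spectral_radius A = rho%:E.

End SpectralRadius.

Section NN.
Variable k : nat.
Implicit Types m n p : NN k.

Lemma leNP m n : reflect (forall i, (m i <= n i)%N) (leN m n).
Proof. exact: forallP. Qed.

Lemma leNn m : leN m m.
Proof. exact/leNP. Qed.

Lemma leN_trans n m p : leN m n -> leN n p -> leN m p.
Proof.
by move=> /leNP h1 /leNP h2; apply/leNP => i; exact: leq_trans (h1 i) (h2 i).
Qed.

Lemma leN_addr m n : leN m (m + n).
Proof. by apply/leNP => i; rewrite ffunE leq_addr. Qed.

Lemma leN_add2r l m n : leN m n -> leN (m + l) (n + l).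
Proof. by move=> /leNP h; apply/leNP => i; rewrite !ffunE leq_add2r. Qed.

Lemma subN_add2r l m n : subN (n + l) (m + l) = subN n m.
Proof. by apply/ffunP => i; rewrite !ffunE subnDr. Qed.

Lemma addKN m n : subN (m + n) m = n.
Proof. by apply/ffunP => i; rewrite !ffunE addKn. Qed.

Lemma subNK m n : leN m n -> m + subN n m = n.
Proof. by move=> /leNP h; apply/ffunP => i; rewrite !ffunE; exact: subnKC. Qed.

Lemma subNn m : subN m m = 0.
Proof. by apply/ffunP => i; rewrite !ffunE subnn. Qed.

Lemma subN_add m n p : leN m n -> leN n p ->
  subN p m = subN n m + subN p n.
Proof.
move=> /leNP h1 /leNP h2; apply/ffunP => i; rewrite !ffunE.
change (p i - m i = (n i - m i) + (p i - n i))%N.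
by rewrite addnC addnBA ?subnK.
Qed.

Definition omega_mor := {pq : NN k * NN k | leN pq.1 pq.2}.

Definition omega_rng (a : omega_mor) : omega_mor :=
  exist _ ((val a).1, (val a).1) (leNn _).
Definition omega_src (a : omega_mor) : omega_mor :=
  exist _ ((val a).2, (val a).2) (leNn _).
Definition omega_comp (a b : omega_mor) : omega_mor :=
  insubd a ((val a).1, (val b).2).
Definition omega_deg (a : omega_mor) : NN k := subN (val a).2 (val a).1.

Lemma val_omega_comp a b : omega_src a = omega_rng b ->
  val (omega_comp a b) = ((val a).1, (val b).2).
Proof.
move=> /(congr1 val) [] e; rewrite /omega_comp val_insubd /=.
case: ifP => // /negP []; apply: leN_trans (valP a) _.
by move: (valP b); rewrite -e.
Qed.

End NN.

Section Omega.
Variable k : nat.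
Implicit Types a b c l m n : omega_mor k.

Let rr l : omega_rng (omega_rng l) = omega_rng l. Proof. exact: val_inj. Qed.
Let sr l : omega_src (omega_rng l) = omega_rng l. Proof. exact: val_inj. Qed.
Let rs l : omega_rng (omega_src l) = omega_src l. Proof. exact: val_inj. Qed.
Let ss l : omega_src (omega_src l) = omega_src l. Proof. exact: val_inj. Qed.

Let rc l m : omega_src l = omega_rng m ->
  omega_rng (omega_comp l m) = omega_rng l.
Proof. by move=> e; apply: val_inj; rewrite /= val_omega_comp. Qed.

Let sc l m : omega_src l = omega_rng m ->
  omega_src (omega_comp l m) = omega_src m.
Proof. by move=> e; apply: val_inj; rewrite /= val_omega_comp. Qed.

Let idl l : omega_comp (omega_rng l) l = l.
Proof.
by apply: val_inj; rewrite val_omega_comp ?sr//=; case: (val l).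
Qed.

Let idr l : omega_comp l (omega_src l) = l.
Proof.
by apply: val_inj; rewrite val_omega_comp ?rs//=; case: (val l).
Qed.

Let assoc l m n : omega_src l = omega_rng m -> omega_src m = omega_rng n ->
  omega_comp l (omega_comp m n) = omega_comp (omega_comp l m) n.
Proof.
move=> e1 e2; apply: val_inj; rewrite val_omega_comp ?rc//.
by rewrite [RHS]val_omega_comp ?sc// !val_omega_comp.
Qed.

Let dr l : omega_deg (omega_rng l) = 0. Proof. exact: subNn. Qed.
Let ds l : omega_deg (omega_src l) = 0. Proof. exact: subNn. Qed.

Let dc l m : omega_src l = omega_rng m ->
  omega_deg (omega_comp l m) = omega_deg l + omega_deg m.
Proof.
move=> e; rewrite /omega_deg val_omega_comp//=.
have {}e : (val l).2 = (val m).1 by move: e => /(congr1 val) [].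
have hm := valP m; rewrite -e in hm *.
exact: subN_add (valP l) hm.
Qed.

Let fact l (p q : NN k) : omega_deg l = p + q ->
  exists! mg : omega_mor k * omega_mor k,
    [/\ omega_deg mg.1 = p, omega_deg mg.2 = q,
        omega_src mg.1 = omega_rng mg.2 & l = omega_comp mg.1 mg.2].
Proof.
case: l => -[x y] /= hxy; rewrite /omega_deg /= => e.
have ey : y = x + p + q by rewrite -addrA -e subNK.
subst y.
exists (exist _ (x, x + p) (leN_addr _ _),
        exist _ (x + p, x + p + q) (leN_addr _ _)); split=> /=.
  by split; rewrite ?addKN //; apply: val_inj; rewrite val_omega_comp.
case=> -[[a b] hab] [[c d] hcd] /= [e1 e2 e3 e4].
have e5 : b = c by move: e3 => /(congr1 val) [].
move: e4 => /(congr1 val); rewrite val_omega_comp//= => -[e6 e7].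
subst a d.
have eb : b = x + p by rewrite -e1 subNK.
by subst c b; f_equal; exact: val_inj.
Qed.

Definition Omega : kgraph k :=
  KGraph rr sr rs ss rc sc idl idr assoc dr ds dc fact.

Definition omega_at (m q : NN k) : Omega :=
  exist _ (m, m + q) (leN_addr _ _).

Definition omega_shift (l : NN k) (a : Omega) : Omega :=
  exist _ ((val a).1 + l, (val a).2 + l) (leN_add2r l (valP a)).

End Omega.

Definition is_functor k (L M : kgraph k) (x : L -> M) : Prop :=
  [/\ forall a, krng (x a) = x (krng a),
      forall a, ksrc (x a) = x (ksrc a)
    & forall a b, ksrc a = krng b -> x (kcomp a b) = kcomp (x a) (x b)].

Record ipath k (L : kgraph k) := IPath {
  ipath_fun :> Omega k -> L;
  ipath_functor : is_functor ipath_fun;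
  ipath_deg : forall a, kdeg (ipath_fun a) = kdeg a
}.

HB.instance Definition _ k (L : kgraph k) := gen_eqMixin (ipath L).
HB.instance Definition _ k (L : kgraph k) := gen_choiceMixin (ipath L).

Section InfinitePaths.
Variables (k : nat) (L : kgraph k).

Lemma ipath_eq (x y : ipath L) : (forall a, x a = y a) -> x = y.
Proof.
case: x y => [x fx dx] [y fy dy] /= /funext e; subst y.
by congr IPath; exact: Prop_irrelevance.
Qed.

Definition ipath_rng (x : ipath L) : L := x (omega_at 0 0).

Let shift_functor (l : NN k) (x : ipath L) :
  is_functor (fun a => x (omega_shift l a)).
Proof.
have [hr hs hc] := ipath_functor x; split=> [a|a|a b e].
- by rewrite hr; congr (x _); exact: val_inj.
- by rewrite hs; congr (x _); exact: val_inj.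
have e' : ksrc (omega_shift l a) = krng (omega_shift l b).
  by apply: val_inj; move: e => /(congr1 val) [] /= ->.
rewrite -hc//; congr (x _); apply: val_inj => /=.
by rewrite !val_omega_comp.
Qed.

Let shift_deg (l : NN k) (x : ipath L) a :
  kdeg (x (omega_shift l a)) = kdeg a.
Proof. by rewrite ipath_deg; exact: subN_add2r. Qed.

Definition ipath_shift (l : NN k) (x : ipath L) : ipath L :=
  IPath (@shift_functor l x) (@shift_deg l x).

Lemma ipath_shiftD (l m : NN k) (x : ipath L) :
  ipath_shift l (ipath_shift m x) = ipath_shift (l + m) x.
Proof.
by apply: ipath_eq => a /=; congr (x _); apply: val_inj; rewrite /= !addrA.
Qed.

(* [ipath_cat l x y] states that y = l x, which determines y. *)
Definition ipath_cat (l : L) (x y : ipath L) : Prop :=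
  [/\ ksrc l = ipath_rng x, y (omega_at 0 (kdeg l)) = l
    & ipath_shift (kdeg l) y = x].

End InfinitePaths.

Definition groupoid_rel k (L : kgraph k) (x : ipath L) (l : ZZ k)
    (y : ipath L) : Prop :=
  exists p q : NN k,
    l = toZZ p - toZZ q /\ ipath_shift p x = ipath_shift q y.

Record groupoid k (L : kgraph k) := GroupoidElt {
  grng : ipath L;
  gdeg : ZZ k;
  gsrc : ipath L;
  groupoidP : groupoid_rel grng gdeg gsrc
}.

HB.instance Definition _ k (L : kgraph k) := gen_eqMixin (groupoid L).
HB.instance Definition _ k (L : kgraph k) := gen_choiceMixin (groupoid L).

Section Groupoid.
Variables (k : nat) (L : kgraph k).
Local Notation G := (groupoid L).

Lemma toZZD (m n : NN k) : toZZ (m + n) = toZZ m + toZZ n.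
Proof. by apply/ffunP => i; rewrite !ffunE PoszD. Qed.

Let rel_inv (a : G) : groupoid_rel (gsrc a) (- gdeg a) (grng a).
Proof.
have [p [q [e h]]] := groupoidP a.
by exists q, p; split; rewrite // e opprB.
Qed.

Definition ginv (a : G) : G := GroupoidElt (rel_inv a).

Let rel_mul (a b : G) : gsrc a = grng b ->
  groupoid_rel (grng a) (gdeg a + gdeg b) (gsrc b).
Proof.
have [p [q [e h]]] := groupoidP a; have [p' [q' [e' h']]] := groupoidP b.
move=> ab; exists (p' + p), (q + q'); split.
  by rewrite e e' !toZZD opprD addrACA [toZZ p + _]addrC.
by rewrite -[LHS]ipath_shiftD h ab [LHS]ipath_shiftD addrC -!ipath_shiftD h'.
Qed.

(* The groupoid product; the value is irrelevant unless [gsrc a = grng b]. *)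
Definition gmul (a b : G) : G :=
  match pselect (gsrc a = grng b) with
  | left ab => GroupoidElt (rel_mul ab)
  | right _ => a
  end.

Definition cylinder (l m : L) : set G :=
  [set g | exists x, [/\ ipath_cat l x (grng g), ipath_cat m x (gsrc g)
                       & gdeg g = toZZ (kdeg l) - toZZ (kdeg m)]].

End Groupoid.

HB.instance Definition _ k (L : kgraph k) :=
  @isSubBaseTopological.Build (groupoid L) (set (groupoid L))
    [set cylinder lm.1 lm.2 | lm in [set lm : L * L | ksrc lm.1 = ksrc lm.2]]
    id.

Section Cocycles.
Variables (R : realType) (k : nat) (L : kgraph k).
Local Notation G := (groupoid L).

(* Z^2(Lambda, T); only the values on composable pairs matter. *)
Definition is_2cocycle (omega : L -> L -> R[i]) : Prop :=
  [/\ forall l m, ksrc l = krng m -> `|omega l m| = 1,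
      forall l, omega (krng l) l = 1 /\ omega l (ksrc l) = 1
    & forall l m n, ksrc l = krng m -> ksrc m = krng n ->
        omega l m * omega (kcomp l m) n = omega l (kcomp m n) * omega m n].

Definition is_cylinder_partition (P : set (L * L)) : Prop :=
  [/\ P `<=` [set lm | ksrc lm.1 = ksrc lm.2],
      forall l, P (l, ksrc l),
      trivIset P (fun lm => cylinder lm.1 lm.2)
    & \bigcup_(lm in P) cylinder lm.1 lm.2 = [set: G]].

(* a = (l n y, gdeg a, m n y) *)
Definition groupoid_factor (l m n : L) (y : ipath L) (a : G) : Prop :=
  [/\ ksrc l = krng n, ksrc m = krng n, ipath_cat (kcomp l n) y (grng a)
    & ipath_cat (kcomp m n) y (gsrc a)].

(* By independence of the choices there is exactly one value when a and b are
   composable. *)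
Definition tau_values (P : set (L * L)) (omega : L -> L -> R[i]) (a b : G)
    : set R[i] :=
  [set z | exists la ma lb mb lc mc nu xi zeta : L, exists y : ipath L,
     [/\ [/\ P (la, ma), P (lb, mb) & P (lc, mc)],
         [/\ cylinder la ma a, cylinder lb mb b & cylinder lc mc (gmul a b)],
         [/\ kcomp ma nu = kcomp lb xi, kcomp la nu = kcomp lc zeta
           & kcomp mb xi = kcomp mc zeta],
         [/\ groupoid_factor la ma nu y a, groupoid_factor lb mb xi y b
           & groupoid_factor lc mc zeta y (gmul a b)]
       & z = omega la nu * (omega ma nu)^*%C * omega lb xi * (omega mb xi)^*%C
             * (omega lc zeta)^*%C * omega mc zeta]].

Definition tau (P : set (L * L)) (omega : L -> L -> R[i]) (a b : G) : R[i] :=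
  xget 1 (tau_values P omega a b).

Definition path_cocycle (rho : 'I_k -> R) (g : G) : R :=
  \sum_(i < k) (gdeg g i)%:~R * ln (rho i).

End Cocycles.

(* Units are not required: C*(Lambda; omega) has none when Lambda^0 is infinite,
   so the library's rings do not apply. *)
Record cstar_algebra (R : realType) := CStarAlgebra {
  cs_space :> completeNormedModType R[i];
  cmul : cs_space -> cs_space -> cs_space;
  cadj : cs_space -> cs_space;
  cmulA : forall a b c, cmul a (cmul b c) = cmul (cmul a b) c;
  cmulDl : forall a b c, cmul (a + b) c = cmul a c + cmul b c;
  cmulDr : forall a b c, cmul a (b + c) = cmul a b + cmul a c;
  cmulZl : forall (z : R[i]) a b, cmul (z *: a) b = z *: cmul a b;
  cmulZr : forall (z : R[i]) a b, cmul a (z *: b) = z *: cmul a b;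
  cadjK : forall a, cadj (cadj a) = a;
  cadjD : forall a b, cadj (a + b) = cadj a + cadj b;
  cadjZ : forall (z : R[i]) a, cadj (z *: a) = z^*%C *: cadj a;
  cadjM : forall a b, cadj (cmul a b) = cmul (cadj b) (cadj a);
  cmul_norm : forall a b, `|cmul a b| <= `|a| * `|b|;
  cstar_norm : forall a, `|cmul (cadj a) a| = `|a| ^+ 2
}.

Section CStar.
Variable R : realType.
Implicit Types A B : cstar_algebra R.

Definition is_star_hom A B (f : A -> B) : Prop :=
  [/\ forall a b, f (a + b) = f a + f b,
      forall (z : R[i]) a, f (z *: a) = z *: f a,
      forall a b, f (cmul a b) = cmul (f a) (f b)
    & forall a, f (cadj a) = cadj (f a)].

Definition is_star_iso A B (f : A -> B) : Prop := is_star_hom f /\ bijective f.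

Definition is_closed_star_subalgebra A (S : set A) : Prop :=
  [/\ closed S /\ S 0, forall a b, S a -> S b -> S (a + b),
      forall (z : R[i]) a, S a -> S (z *: a),
      forall a b, S a -> S b -> S (cmul a b)
    & forall a, S a -> S (cadj a)].

Definition generates A (X : set A) : Prop :=
  forall S : set A, is_closed_star_subalgebra S -> X `<=` S -> S = setT.

(* A strongly continuous one-parameter group of *-automorphisms (bijectivity
   follows from the group law, and the continuity of each automorphism is
   automatic in a C*-algebra). *)
Definition is_dynamics A (sigma : R -> A -> A) : Prop :=
  [/\ forall t, is_star_hom (sigma t) /\ continuous (sigma t),
      forall a, sigma 0 a = a,
      forall s t a, sigma (s + t) a = sigma s (sigma t a)
    & forall a, continuous (fun t : R => sigma t a)].

Definition is_state A (psi : A -> R[i]) : Prop :=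
  [/\ forall a b, psi (a + b) = psi a + psi b,
      forall (z : R[i]) a, psi (z *: a) = z * psi a,
      forall a, 0 <= psi (cmul (cadj a) a)
    & ereal_sup [set (complex.Re `|psi a|)%:E | a in [set a : A | `|a| <= 1]]
      = 1%:E].

Definition entire A (F : R[i] -> A) : Prop :=
  forall z : R[i], derivable (F : R[i]^o -> A) z 1.

(* [F] is z |-> sigma_z(b); it is unique, if it exists (that is, if b is
   analytic). *)
Definition analytic_extension A (sigma : R -> A -> A) (b : A) (F : R[i] -> A)
    : Prop :=
  entire F /\ forall t : R, F t%:C = sigma t b.

Definition is_ground_state A (sigma : R -> A -> A) (psi : A -> R[i]) : Prop :=
  is_state psi /\
  forall (a b : A) (F : R[i] -> A), analytic_extension sigma b F ->
    exists M : R, forall z : R[i], 0 <= complex.Im z ->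
      `|psi (cmul a (F z))| <= M%:C.

End CStar.

Section TwistedKGraphAlgebra.
Variables (R : realType) (k : nat) (L : kgraph k) (omega : L -> L -> R[i]).

Definition is_twisted_family (A : cstar_algebra R) (t : L -> A) : Prop :=
  [/\ (forall l, cmul (cmul (t l) (cadj (t l))) (t l) = t l) /\
      (forall v : vertex L, cadj (t (val v)) = t (val v) /\
                            cmul (t (val v)) (t (val v)) = t (val v)),
      forall u v : vertex L, u <> v -> cmul (t (val u)) (t (val v)) = 0,
      forall l m, ksrc l = krng m ->
        cmul (t l) (t m) = omega l m *: t (kcomp l m),
      forall l, cmul (cadj (t l)) (t l) = t (ksrc l)
    & forall (v : vertex L) (n : NN k),
        t (val v) = \sum_(l \in paths_from (val v) n) cmul (t l) (cadj (t l))].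

(* (A, t) is C*(Lambda; omega). *)
Definition is_twisted_kgraph_algebra (A : cstar_algebra R) (t : L -> A)
    : Prop :=
  [/\ is_twisted_family t, generates (range t)
    & forall (B : cstar_algebra R) (u : L -> B), is_twisted_family u ->
        exists2 f : A -> B, is_star_hom f & forall l, f (t l) = u l].

End TwistedKGraphAlgebra.

Section TwistedGroupoidAlgebra.
Variables (R : realType) (k : nat) (L : kgraph k).
Local Notation G := (groupoid L).
Variable sigma : G -> G -> R[i].

Definition Cc : set (G -> R[i]) :=
  [set f | continuous (f : G -> R[i]^o) /\ compact (closure [set g | f g != 0])].

(* The sum has finite support for f, g in Cc, since the groupoid is etale. *)
Definition convolution (f g : G -> R[i]) (c : G) : R[i] :=
  \sum_(a \in [set a | grng a = grng c])
    sigma a (gmul (ginv a) c) * f a * g (gmul (ginv a) c).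

Definition involution (f : G -> R[i]) (c : G) : R[i] :=
  (sigma c (ginv c) * f (ginv c))^*%C.

(* A *-homomorphism from Cc(G; sigma); the values off Cc are irrelevant. *)
Definition is_Cc_hom (A : cstar_algebra R) (pi : (G -> R[i]) -> A) : Prop :=
  [/\ forall f g, Cc f -> Cc g -> pi (fun c => f c + g c) = pi f + pi g,
      forall (z : R[i]) f, Cc f -> pi (fun c => z * f c) = z *: pi f,
      forall f g, Cc f -> Cc g -> pi (convolution f g) = cmul (pi f) (pi g)
    & forall f, Cc f -> pi (involution f) = cadj (pi f)].

(* (A, iota) is C*(G; sigma), the enveloping C*-algebra of Cc(G; sigma). *)
Definition is_twisted_groupoid_algebra (A : cstar_algebra R)
    (iota : (G -> R[i]) -> A) : Prop :=
  [/\ is_Cc_hom iota, closure (iota @` Cc) = setT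
    & forall (B : cstar_algebra R) (pi : (G -> R[i]) -> B), is_Cc_hom pi ->
        exists2 f : A -> B, is_star_hom f &
          forall h, Cc h -> f (iota h) = pi h].

Definition expi (x : R) : R[i] := cos x +i* sin x.

Definition is_cocycle_dynamics (A : cstar_algebra R) (iota : (G -> R[i]) -> A)
    (c : G -> R) (dyn : R -> A -> A) : Prop :=
  is_dynamics dyn /\
  forall (t : R) (f : G -> R[i]), Cc f ->
    dyn t (iota f) = iota (fun g => expi (t * c g) * f g).

End TwistedGroupoidAlgebra.

(* Main.v *)
(** Put h(n) = sum_i n_i ln(rho_i), so that sigma^c_s(t_l) = e^(i s h(d(l))) t_l.

    If all rho_i are 1, the dynamics is trivial, and an analytic extension F of
    s |-> sigma_s(b) is an entire function which is constant on the real line.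
    Hence psi(a F(z)) - psi(a b) is entire and vanishes on the real line, so it
    vanishes identically.

    If h(e_i) is nonzero for some i, let psi be a ground state.  For b = t_l and
    h(d(l)) < 0 (or b = t_l^* and h(d(l)) > 0) the extension of the orbit of b is
    a multiple of b which grows exponentially on the upper half plane, so
    psi(a b) = 0 for all a.  With d(l) = e_i this gives psi(a t_v) = 0 for all
    vertices v: if h(e_i) > 0, from t_v = sum t_l t_l^* over the paths l of
    degree e_i with range v, and if h(e_i) < 0, from t_v = t_l^* t_l, since by
    strong connectivity each v is the source of a path l of degree e_i.  As the
    t_v act as local units for the generators, psi = 0, which is absurd.

    The identity theorem needed in the first case is proved without power
    series.  Goursat's subdivision argument gives an antiderivative G of f that
    vanishes on the real axis; having one more derivative than f, |G|^2 times
    the exponential of a strictly subharmonic weight has no interior maximum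
    unless it vanishes there, and weights that are large near a given point but
    small on the part of the boundary of a rectangle off the axis force G = 0. *)
Require Import Defs.
From HB Require Import structures.
From mathcomp Require Import all_boot all_order all_algebra.
From mathcomp Require Import complex finmap.
From mathcomp Require Import all_classical all_reals all_analysis.
From mathcomp Require Import ring lra.

Set Implicit Arguments.
Unset Strict Implicit.
Unset Printing Implicit Defensive.

Import Order.TTheory GRing.Theory Num.Theory.
Import numFieldNormedType.Exports.

Local Open Scope classical_set_scope.
Local Open Scope complex_scope.
Local Open Scope ring_scope.

(* [all_analysis] shadows this name by the composition of kernels. *)
Local Notation kcomp := Defs.kcomp.

(** * Goursat's theorem and primitives *)

Section Primitive.
Variable R : realType.
Implicit Types (f F : R -> R) (a b x y : R).

Lemma eq_derive_subr F G a b f : a <= b ->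
  (forall x, x \in `[a, b] -> is_derive x 1 F (f x)) ->
  (forall x, x \in `[a, b] -> is_derive x 1 G (f x)) -> F b - F a = G b - G a.
Proof.
move=> ab dF dG.
have dFG x : x \in `[a, b] -> is_derive x 1 (F - G) 0.
  move=> xab; rewrite -(subrr (f x)).
  by apply: is_deriveB; [exact: dF|exact: dG].
have cFG : {within `[a, b], continuous (F - G)}.
  by apply: derivable_within_continuous => x /dFG h; exact: ex_derive.
have dFG' x : x \in `]a, b[ -> is_derive x 1 (F - G) ((fun=> 0) x).
  by move=> /subset_itv_oo_cc; exact: dFG.
have [c _] := MVT_segment ab dFG' cFG.
by rewrite mul0r !fctE; lra.
Qed.

Lemma primitive_right f a : continuous f ->
  exists F, forall x, a < x -> is_derive x 1 F (f x).
Proof.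
move=> cf; exists (fun x => (\int[lebesgue_measure]_(t in `[a, x]) f t)%R).
move=> x ax.
have intf : lebesgue_measure.-integrable `[a, x + 1] (EFin \o f).
  apply: continuous_compact_integrable; first exact: segment_compact.
  exact: continuous_subspaceT.
have [|dF <-] := continuous_FTC1_closed _ intf ax (cf x).
  by rewrite ltrDl.
by rewrite derive1E; exact/derivableP.
Qed.

(** The integral from [- n] has derivative [f] only to the right of [- n]. Normalised to vanish at
    [0], these integrals agree wherever [|x| < n], so they glue to a primitive on the whole line. *)
Lemma primitive f : continuous f -> exists F, forall x, is_derive x 1 F (f x).
Proof.
move=> cf; have /choice[F dF] := fun n : nat => primitive_right (- n%:R) cf.
have /choice[N xN] : forall x, exists N : nat, `|x| < N%:R.
  move=> x; exists (Num.truncn `|x|).+1.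
  by have /andP[] := truncn_itv (normr_ge0 x).
have F_indep n x : `|x| < n%:R -> F n x - F n 0 = F (N x) x - F (N x) 0.
  move=> xn; move: (xn) (xN x); rewrite !ltr_norml => /andP[n1 n2] /andP[n3 n4].
  have n5 : 0 < n%:R :> R by exact: le_lt_trans (normr_ge0 _) xn.
  have n6 : 0 < (N x)%:R :> R by exact: le_lt_trans (normr_ge0 _) (xN x).
  have [x0|/ltW x0] := leP 0 x.
    apply: (@eq_derive_subr _ _ 0 x f) => // y;
      by rewrite in_itv/= => /andP[y0 yx]; apply: dF; lra.
  suff : F n 0 - F n x = F (N x) 0 - F (N x) x by lra.
  apply: (@eq_derive_subr _ _ x 0 f) => // y;
    by rewrite in_itv/= => /andP[y0 yx]; apply: dF; lra.
exists (fun x => F (N x) x - F (N x) 0) => x.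
(* The index [N y] may jump as [y] varies near [x], but [(N x).+1] is admissible for every [y]
   within distance [1] of [x]. *)
apply: (@near_eq_is_derive _ _ _ (F (N x).+1 - cst (F (N x).+1 0))).
  near=> y; rewrite -(F_indep (N x).+1)//.
  have : `|y - x| < 1.
    near: y; apply/nbhs_ballP; exists 1 => //= y; rewrite /ball/= => h.
    by rewrite distrC.
  move=> yx; rewrite -natr1; have := xN x; have := ler_normD x (y - x).
  by rewrite addrC subrK; lra.
rewrite -(subr0 (f x)); apply: is_deriveB; apply: dF.
by have := xN x; rewrite -natr1 ltr_norml => /andP[]; lra.
Unshelve. all: by end_near. Qed.

End Primitive.

(** * Repeated bisection of a rectangle *)

Section Bisection.
Variable R : realType.

Lemma nested_intervals (u v : nat -> R) : (forall n, u n <= u n.+1) ->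
  (forall n, v n.+1 <= v n) -> (forall n, u n <= v n) ->
  exists x, forall n, u n <= x <= v n.
Proof.
move=> /nondecreasing_seqP nu /nonincreasing_seqP nv uv.
have uvmn m n : u m <= v n.
  apply: le_trans (nu _ _ (leq_maxl m n)) _.
  by apply: le_trans (uv _) (nv _ _ (leq_maxr m n)).
exists (sup (range u)) => n; apply/andP; split.
  by apply: ub_le_sup; [exists (v 0%N) => _ [m _ <-]|exists n].
by apply: ge_sup; [exists (u 0%N), 0%N|move=> _ [m _ <-]].
Qed.

(* [J a c r] is meant as a quantity attached to the rectangle
   [[a, a + r * w] x [c, c + r * h]]. *)
Lemma bisection (J : R -> R -> R -> R) (w h : R) : 0 <= w -> 0 <= h ->
  (forall a c r, `|J a c r| <= `|J a c (r / 2)| + `|J (a + r / 2 * w) c (r / 2)|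
     + `|J a (c + r / 2 * h) (r / 2)|
     + `|J (a + r / 2 * w) (c + r / 2 * h) (r / 2)|) ->
  (forall x y e, 0 < e -> exists2 d, 0 < d &
     forall a c r, 0 < r -> r <= d -> a <= x <= a + r * w ->
       c <= y <= c + r * h -> `|J a c r| <= e * r ^+ 2) ->
  forall a c, J a c 1 = 0.
Proof.
move=> w0 h0 Jsub Jloc a c; apply/eqP; rewrite -normr_eq0.
have [//|K0] := eqVneq `|J a c 1| 0.
have {}K0 : 0 < `|J a c 1| by rewrite lt_neqAle eq_sym K0 normr_ge0.
(* One of the four quarters carries at least a quarter of [|J|]; [p] is its lower left corner. *)
pose ok (q : R * R * R) (p : R * R) :=
  [/\ `|J q.1.1 q.1.2 q.2| <= 4 * `|J p.1 p.2 (q.2 / 2)|,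
      p.1 = q.1.1 \/ p.1 = q.1.1 + q.2 / 2 * w
    & p.2 = q.1.2 \/ p.2 = q.1.2 + q.2 / 2 * h].
have /choice[nxt nxtP] : forall q, exists p, ok q p.
  move=> [[x y] r]; apply: contrapT => /forallNP nok.
  have {}nok p1 p2 : p1 = x \/ p1 = x + r / 2 * w ->
      p2 = y \/ p2 = y + r / 2 * h ->
      4 * `|J p1 p2 (r / 2)| < `|J x y r|.
    move=> h1 h2; rewrite ltNge; apply/negP => h3.
    by apply: (nok (p1, p2)); split.
  have := Jsub x y r.
  have := nok _ _ (or_introl erefl) (or_introl erefl).
  have := nok _ _ (or_intror erefl) (or_introl erefl).
  have := nok _ _ (or_introl erefl) (or_intror erefl).
  have := nok _ _ (or_intror erefl) (or_intror erefl).
  lra.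
pose fix z n := if n is m.+1 then nxt (z m, 2^-1 ^+ m) else (a, c).
have r0 n : 0 < 2^-1 ^+ n :> R by rewrite exprn_gt0// invr_gt0.
have rS n : 2^-1 ^+ n / 2 = 2^-1 ^+ n.+1 :> R by rewrite exprSr.
have zJ n : `|J a c 1| <= 4 ^+ n * `|J (z n).1 (z n).2 (2^-1 ^+ n)|.
  elim: n => [|n IH]; first by rewrite !expr0 mul1r.
  apply: le_trans IH _; rewrite exprSr -mulrA ler_wpM2l ?exprn_ge0//.
  by rewrite -rS; have [] := nxtP (z n, 2^-1 ^+ n).
have shrink (u v s : R) : 0 <= s -> 0 <= v ->
    forall p, p = u \/ p = u + s / 2 * v ->
    u <= p /\ p + s / 2 * v <= u + s * v.
  by move=> s0 v0 p; case=> ->; have := mulr_ge0 s0 v0; lra.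
have [x hx] : exists x, forall n, (z n).1 <= x <= (z n).1 + 2^-1 ^+ n * w.
  apply: nested_intervals => n; last by rewrite lerDl mulr_ge0// ltW.
    by have [_ /(shrink _ _ _ (ltW (r0 n)) w0)[]] := nxtP (z n, 2^-1 ^+ n).
  by rewrite -rS; have [_ /(shrink _ _ _ (ltW (r0 n)) w0)[]] :=
    nxtP (z n, 2^-1 ^+ n).
have [y hy] : exists y, forall n, (z n).2 <= y <= (z n).2 + 2^-1 ^+ n * h.
  apply: nested_intervals => n; last by rewrite lerDl mulr_ge0// ltW.
    by have [_ _ /(shrink _ _ _ (ltW (r0 n)) h0)[]] := nxtP (z n, 2^-1 ^+ n).
  by rewrite -rS; have [_ _ /(shrink _ _ _ (ltW (r0 n)) h0)[]] :=
    nxtP (z n, 2^-1 ^+ n).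
(* The [n]-th rectangle has scale [2^-n], so the local bound absorbs the factor [4 ^+ n] of [zJ].
   With [e] equal to half of [|J a c 1|] this gives [|J a c 1| <= |J a c 1| / 2]. *)
have [|d d0 hd] := Jloc x y (`|J a c 1| / 2); first by rewrite divr_gt0.
have [n nd] : exists n, 2^-1 ^+ n <= d.
  have /cvgrPdist_le/(_ _ d0)[n _ /(_ n)] :
      (fun n => 2^-1 ^+ n : R) @ \oo --> (0 : R).
    by apply: cvg_expr; rewrite ger0_norm; lra.
  move=> /(_ (leqnn n)); rewrite sub0r normrN ger0_norm => [h'|];
    last exact: ltW.
  by exists n.
have := hd _ _ _ (r0 n) nd (hx n) (hy n).
move/(ler_wpM2l (exprn_ge0 n (ler0n R 4))) => /(le_trans (zJ n)).
have -> : 4 ^+ n * (`|J a c 1| / 2 * 2^-1 ^+ n ^+ 2) = `|J a c 1| / 2.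
  have -> : 2^-1 ^+ n ^+ 2 = (4 ^+ n)^-1 :> R.
    by rewrite -exprM mulnC exprM -exprVn; congr (_ ^+ _); field.
  by field; rewrite expf_neq0.
by lra.
Qed.

End Bisection.

(** * Circulation around rectangles and potentials of closed forms *)

Section Goursat.
Variable R : realType.
Implicit Types (F f : R -> R) (M N G : R -> R -> R).
Implicit Types (a b c d e u v w h x y r s t : R).

(** Real differentiability at [(x, y)] with gradient [(a, b)], the error being measured in the l^1
    norm. *)
Definition diff2 M x y a b := forall e, 0 < e -> exists2 d, 0 < d &
  forall s t, `|s - x| <= d -> `|t - y| <= d ->
    `|M s t - (M x y + a * (s - x) + b * (t - y))| <= e * (`|s - x| + `|t - y|).

Lemma derive_le_dist F f a b (B : R) : a <= b ->
  (forall x, x \in `[a, b] -> is_derive x 1 F (f x)) ->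
  (forall x, x \in `[a, b] -> `|f x| <= B) -> `|F b - F a| <= B * (b - a).
Proof.
move=> ab dF fB.
have cF : {within `[a, b], continuous F}.
  by apply: derivable_within_continuous => x /dF h; exact: ex_derive.
have dF' x : x \in `]a, b[ -> is_derive x 1 F (f x).
  by move=> /subset_itv_oo_cc; exact: dF.
have [c cab ->] := MVT_segment ab dF' cF.
by rewrite normrM [X in _ * X]ger0_norm ?subr_ge0// ler_wpM2r ?subr_ge0// fB.
Qed.

Section Rectangle.
Variables (M N P Q : R -> R -> R).
Hypothesis dP : forall y x, is_derive x 1 (P y) (M x y).
Hypothesis dQ : forall x y, is_derive y 1 (Q x) (N x y).
Hypothesis dMN : forall x y, exists a b c, diff2 M x y a b /\ diff2 N x y b c.

(* The integral of [M dx + N dy] around [[a, b] x [c, d]]. *)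
Let circ a b c d := (P c b - P c a) + (Q b d - Q b c)
                    - (P d b - P d a) - (Q a d - Q a c).

(** The affine part of the form is exact and has no circulation. The remainder is at most [e'] times
    the size of the rectangle, and the mean value inequality on each side brings in a second factor
    of that size. *)
Let circ_local (w h : R) (w0 : 0 <= w) (h0 : 0 <= h) x y (e : R) : 0 < e ->
  exists2 d, 0 < d & forall a c (r : R), 0 < r -> r <= d ->
    a <= x <= a + r * w -> c <= y <= c + r * h ->
    `|circ a (a + r * w) c (c + r * h)| <= e * r ^+ 2.
Proof.
move=> e0; have [al [be [ga [dM dN]]]] := dMN x y.
(* The half-perimeter is at most [r * T], and the [1] makes [T] positive. Two adjacent sides
   contribute at most [e' * (r * T) ^+ 2], so [e'] is chosen with [2 * e' * T ^+ 2 = e]. *)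
pose T := w + h + 1.
have T0 : 0 < T by rewrite /T; lra.
pose e' := e / (2 * T ^+ 2).
have e'0 : 0 < e' by rewrite divr_gt0// mulr_gt0// exprn_gt0.
have [d1 d10 hM] := dM _ e'0; have [d2 d20 hN] := dN _ e'0.
exists (Num.min d1 d2 / T); first by rewrite divr_gt0// lt_min d10.
move=> a c r r0; rewrite ler_pdivlMr// le_min => /andP[rd1 rd2].
move=> /andP[ax xa] /andP[cy yc].
set b := a + r * w in xa *; set d := c + r * h in yc *.
have ab : a <= b by rewrite /b lerDl mulr_ge0// ltW.
have cd : c <= d by rewrite /d lerDl mulr_ge0// ltW.
have rT : r * T = (b - a) + (d - c) + r by rewrite /T /b /d; ring.
(* [m dx + n dy] is what remains of [M dx + N dy] after subtracting its affine
   part, which is exact because its mixed derivatives agree (both are [be]). *)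
pose m s t := M s t - (M x y + al * (s - x) + be * (t - y)).
pose n s t := N s t - (N x y + be * (s - x) + ga * (t - y)).
pose p t s := P t s - (M x y * s + al / 2 * (s - x) ^+ 2 + be * (t - y) * s).
pose q s t := Q s t - (N x y * t + ga / 2 * (t - y) ^+ 2 + be * (s - x) * t).
have dist_s s : s \in `[a, b] -> `|s - x| <= b - a.
  by rewrite in_itv/= ler_norml => /andP[? ?]; apply/andP; split; lra.
have dist_t t : t \in `[c, d] -> `|t - y| <= d - c.
  by rewrite in_itv/= ler_norml => /andP[? ?]; apply/andP; split; lra.
have bnd u v : u <= b - a -> v <= d - c -> e' * (u + v) <= e' * (r * T).
  by move=> ? ?; rewrite ler_wpM2l ?(ltW e'0)//; lra.
have mB s t : s \in `[a, b] -> t \in `[c, d] -> `|m s t| <= e' * (r * T).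
  move=> /dist_s hs /dist_t ht; apply: le_trans (hM _ _ _ _) _; [lra|lra|].
  exact: bnd.
have nB s t : s \in `[a, b] -> t \in `[c, d] -> `|n s t| <= e' * (r * T).
  move=> /dist_s hs /dist_t ht; apply: le_trans (hN _ _ _ _) _; [lra|lra|].
  exact: bnd.
have dp t (s : R) : is_derive s 1 (p t) (m s t).
  by rewrite /p /m; apply: is_derive_eq; rewrite /GRing.scale/=; field.
have dq s (t : R) : is_derive t 1 (q s) (n s t).
  by rewrite /q /n; apply: is_derive_eq; rewrite /GRing.scale/=; field.
have aab : a \in `[a, b] by rewrite in_itv/= lexx.
have bab : b \in `[a, b] by rewrite in_itv/= lexx andbT.
have ccd : c \in `[c, d] by rewrite in_itv/= lexx.
have dcd : d \in `[c, d] by rewrite in_itv/= lexx andbT.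
have ep t : t \in `[c, d] -> `|p t b - p t a| <= e' * (r * T) * (b - a).
  move=> ht; apply: (derive_le_dist ab (fun s _ => dp t s)) => s hs; exact: mB.
have eq_ s : s \in `[a, b] -> `|q s d - q s c| <= e' * (r * T) * (d - c).
  move=> hs; apply: (derive_le_dist cd (fun t _ => dq s t)) => t ht; exact: nB.
have -> : circ a b c d = (p c b - p c a) + (q b d - q b c)
    - (p d b - p d a) - (q a d - q a c) by rewrite /circ /p /q; field.
move: (ep _ ccd) (ep _ dcd) (eq_ _ aab) (eq_ _ bab).
have -> : e * r ^+ 2 = 2 * (e' * (r * T) * (r * T)).
  by rewrite /e'; field; rewrite gt_eqF.
have K0 : 0 <= e' * (r * T) by apply: mulr_ge0; [|apply: mulr_ge0]; exact: ltW.
have : e' * (r * T) * (b - a) + e' * (r * T) * (d - c)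
    <= e' * (r * T) * (r * T).
  by rewrite -mulrDr ler_wpM2l// [leRHS]rT lerDl ltW.
set X := e' * (r * T) * (r * T); set Y := _ * (b - a); set Z := _ * (d - c).
rewrite !ler_norml => YZ /andP[? ?] /andP[? ?] /andP[? ?] /andP[? ?].
by apply/andP; split; lra.
Qed.

Let circ_eq0_le a b c d : a <= b -> c <= d -> circ a b c d = 0.
Proof.
move=> ab cd; have w0 : 0 <= b - a by lra.
have h0 : 0 <= d - c by lra.
pose J x y r := circ x (x + r * (b - a)) y (y + r * (d - c)).
have := @bisection _ J _ _ w0 h0 _ (circ_local w0 h0) a c.
rewrite /J !mul1r !subrKC; apply => x y r.
have half u v : u + r / 2 * v + r / 2 * v = u + r * v by field.
rewrite !half; set x1 := x + r / 2 * _; set y1 := y + r / 2 * _.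
set x2 := x + _; set y2 := y + _.
have -> : circ x x2 y y2 =
    circ x x1 y y1 + circ x1 x2 y y1 + circ x x1 y1 y2 + circ x1 x2 y1 y2.
  by rewrite /circ; ring.
by do 2! [apply: le_trans (ler_normD _ _) _; rewrite lerD2r];
  exact: ler_normD.
Qed.

Lemma goursat_rectangle a b c d : circ a b c d = 0.
Proof.
wlog cd : c d / c <= d.
  move=> h; have [/h//|/ltW/h dc] := leP c d.
  by rewrite -oppr0 -dc /circ; ring.
have [/circ_eq0_le->//|/ltW/circ_eq0_le/(_ cd) ba] := leP a b.
by rewrite -oppr0 -ba /circ; ring.
Qed.

End Rectangle.

Lemma is_derive_eps f x a : (forall e, 0 < e -> exists2 d, 0 < d &
    forall s, `|s - x| <= d -> `|f s - (f x + a * (s - x))| <= e * `|s - x|) ->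
  is_derive x 1 f a.
Proof.
move=> fa.
have cvga : (fun h => h^-1 *: (f (h *: 1 + x) - f x)) @ 0^' --> a.
  apply/cvgrPdist_le => e /fa[d d0 hd].
  near=> h.
  have h0 : h != 0 by near: h; exact: nbhs_dnbhs_neq.
  have hnd : `|h| <= d.
    by near: h; apply: dnbhs0_le.
  have := hd (x + h); rewrite addrAC subrr add0r => /(_ hnd).
  move=> H; rewrite -(@ler_pM2r _ `|h|) ?normr_gt0//; apply: le_trans H.
  rewrite -normrM /GRing.scale/= mulr1 (addrC h x).
  have -> : (a - h^-1 * (f (x + h) - f x)) * h = - (f (x + h) - (f x + a * h)).
    by field.
  by rewrite normrN.
by apply: DeriveDef; [apply/cvg_ex; exists a|exact: cvg_lim].
Unshelve. all: by end_near. Qed.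

Lemma diff2_is_derivel M x y a b : diff2 M x y a b -> is_derive x 1 (M^~ y) a.
Proof.
move=> dM; apply: is_derive_eps => e /dM[d d0 hd]; exists d => // s sd.
have := hd s y sd; rewrite subrr normr0 mulr0 !addr0; apply; exact: ltW.
Qed.

Lemma diff2_is_deriver M x y a b : diff2 M x y a b -> is_derive y 1 (M x) b.
Proof.
move=> dM; apply: is_derive_eps => e /dM[d d0 hd]; exists d => // s sd.
have := hd x s _ sd; rewrite subrr normr0 mulr0 add0r addr0; apply; exact: ltW.
Qed.

(** [G] integrates along the x-axis and then vertically, which makes its y-derivative evident. Since
    the circulation around rectangles vanishes, going up the y-axis first gives the same value,
    whence the x-derivative. *)
Lemma closed_form_potential M N :
  (forall x y, exists a b c, diff2 M x y a b /\ diff2 N x y b c) ->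
  exists G, (forall x y, is_derive x 1 (G^~ y) (M x y)) /\
            (forall x y, is_derive y 1 (G x) (N x y)).
Proof.
move=> dMN.
have /choice[P dP] : forall y, exists P, forall x, is_derive x 1 P (M x y).
  move=> y; apply: primitive => x; have [a [b [c [dM _]]]] := dMN x y.
  have := diff2_is_derivel dM => h.
  by apply: differentiable_continuous; apply/derivable1_diffP; exact: ex_derive.
have /choice[Q dQ] : forall x, exists Q, forall y, is_derive y 1 Q (N x y).
  move=> x; apply: primitive => y; have [a [b [c [_ dN]]]] := dMN x y.
  have := diff2_is_deriver dN => h.
  by apply: differentiable_continuous; apply/derivable1_diffP; exact: ex_derive.
pose G x y := P 0 x - P 0 0 + (Q x y - Q x 0); exists G; split => x y.
  rewrite (_ : G^~ y = P y \+ cst (Q 0 y - Q 0 0 - P y 0)); last first.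
    apply/funext => s; have := goursat_rectangle dP dQ dMN 0 s 0 y.
    by rewrite /G /=; lra.
  by rewrite -[M x y]addr0; apply: is_deriveD.
rewrite (_ : G x = Q x \+ cst (P 0 x - P 0 0 - Q x 0)); last first.
  by apply/funext => s; rewrite /G /=; ring.
by rewrite -[N x y]addr0; apply: is_deriveD.
Qed.

End Goursat.

(** * Holomorphic functions vanishing on the real axis *)

Section HolomorphicUniqueness.
Variable R : realType.
Implicit Types (f p q u v U V : R -> R -> R) (a b c d e x y r s t : R).

Lemma is_deriveP_eps (f : R -> R) x a : is_derive x 1 f a ->
  forall e, 0 < e -> exists2 d, 0 < d &
    forall s, `|s - x| <= d -> `|f s - (f x + a * (s - x))| <= e * `|s - x|.
Proof.
move=> df e e0.
have : (fun h => h^-1 *: (f (h *: 1 + x) - f x)) @ 0^' --> a.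
  by rewrite -(derive_val (is_derive := df)); exact: ex_derive.
move=> /cvgrPdist_le/(_ _ e0); rewrite near_withinE.
move=> /nbhs_ballP[d /= d0 hd]; exists (d / 2); first by rewrite divr_gt0.
move=> s sd; have [->|sx] := eqVneq s x.
  by rewrite subrr mulr0 addr0 subrr normr0 mulr0.
have sx0 : s - x != 0 by rewrite subr_eq0.
have := hd (s - x) _ sx0; rewrite /ball/= sub0r normrN => /(_ _)/wrap[].
  by apply: le_lt_trans sd _; lra.
move=> H; rewrite /GRing.scale/= mulr1 subrK in H.
have -> : f s - (f x + a * (s - x)) =
    - ((a - (s - x)^-1 * (f s - f x)) * (s - x)).
  by field.
by rewrite normrN normrM ler_wpM2r.
Qed.

(** If [f''] were positive, [f'] would be positive just to the right of its zero [c], and the mean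
    value theorem would give a value of [f] larger than [f c]. *)
Lemma second_derivative_max (f f' : R -> R) (f'' : R) a b c :
  (forall x, is_derive x 1 f (f' x)) -> is_derive c 1 f' f'' ->
  a < c < b -> (forall t, a < t < b -> f t <= f c) -> f' c = 0 /\ f'' <= 0.
Proof.
move=> df df' /andP[ac cb] fmax.
have ab : a <= b by apply: ltW; exact: lt_trans cb.
have f'c : f' c = 0.
  have [|||h1 h2] := @derive1_at_max _ f a b c ab.
  - by move=> t _; have := df t => h; exact: ex_derive.
  - by rewrite in_itv/= ac.
  - by move=> t; rewrite in_itv/=; exact: fmax.
  by rewrite -h2; have h := df c; rewrite derive_val.
split => //; rewrite leNgt; apply/negP => f''0.
have [|d d0 hd] := is_deriveP_eps df' (_ : 0 < f'' / 2);
  first by rewrite divr_gt0.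
pose m := Num.min d ((b - c) / 2).
have m0 : 0 < m by rewrite lt_min d0; lra.
have [md mb] : m <= d /\ m <= (b - c) / 2 by rewrite !ge_min !lexx orbT.
have cm : c < c + m by lra.
have cf : {within `[c, c + m], continuous f}.
  apply: derivable_within_continuous => x _; have := df x => h.
  exact: ex_derive.
have [s] := MVT cm (fun x _ => df x) cf.
rewrite in_itv/= => /andP[cs sm] E.
have := hd s; rewrite f'c add0r (@ger0_norm _ (s - c)); last by lra.
rewrite ler_norml => /(_ _)/wrap[|/andP[h _]]; first by lra.
have f's : 0 < f' s.
  have : 0 < f'' * (s - c) by rewrite mulr_gt0//; lra.
  lra.
have : 0 < f' s * (c + m - c) by rewrite mulr_gt0//; lra.
have : f (c + m) <= f c by apply: fmax; lra.
lra.
Qed.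

(* The second derivative test for [ln (p^2 + q^2) + th], multiplied by
   [(p^2 + q^2)^2] so that it also holds where [p = q = 0]. *)
Lemma weighted_max (p q p1 q1 th th1 : R -> R) a b c (p2 q2 th2 : R) :
  (forall x, is_derive x 1 p (p1 x)) -> (forall x, is_derive x 1 q (q1 x)) ->
  (forall x, is_derive x 1 th (th1 x)) -> is_derive c 1 p1 p2 ->
  is_derive c 1 q1 q2 -> is_derive c 1 th1 th2 -> a < c < b ->
  let W t := (p t ^+ 2 + q t ^+ 2) * expR (th t) in
  (forall t, a < t < b -> W t <= W c) ->
  (p c ^+ 2 + q c ^+ 2) * (2 * (p1 c ^+ 2 + q1 c ^+ 2 + p c * p2 + q c * q2)
                           + (p c ^+ 2 + q c ^+ 2) * th2)
    <= 4 * (p c * p1 c + q c * q1 c) ^+ 2.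
Proof.
move=> dp dq dth dp1 dq1 dth1 acb W Wmax; set S := p c ^+ 2 + q c ^+ 2.
pose W1 t := (2 * (p t * p1 t + q t * q1 t)
              + (p t ^+ 2 + q t ^+ 2) * th1 t) * expR (th t).
pose X := p c * p1 c + q c * q1 c.
pose Y := p1 c ^+ 2 + q1 c ^+ 2 + p c * p2 + q c * q2.
pose W2 := (2 * Y + 2 * X * th1 c + S * th2
  + (2 * X + S * th1 c) * th1 c) * expR (th c).
have dW t : is_derive t 1 W (W1 t).
  have := dp t; have := dq t; have := dth t => ? ? ?.
  by rewrite /W /W1; apply: is_derive_eq; rewrite /GRing.scale/=; ring.
have dW1 : is_derive c 1 W1 W2.
  have := dp c; have := dq c; have := dth c => ? ? ?.
  rewrite /W1 /W2 /X /Y /S; apply: is_derive_eq.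
  by rewrite /GRing.scale/=; ring.
have [] := second_derivative_max dW dW1 acb Wmax.
have E0 := expR_gt0 (th c).
move=> /eqP; rewrite /W1 mulf_eq0 [X in _ || X]gt_eqF// orbF => /eqP XS.
rewrite /W2 pmulr_lle0// -/X -/S XS mul0r addr0 => H.
have S0 : 0 <= S by rewrite addr_ge0// sqr_ge0.
(* Multiplying by [S] produces the product [S * th1 c], which equals [- 2 * X] because [W1] vanishes
   at [c]; this is the source of the term [4 * X ^+ 2]. *)
have := mulr_ge0_le0 S0 H; rewrite -/Y.
have -> : S * (2 * Y + 2 * X * th1 c + S * th2) =
  S * (2 * Y + S * th2) + 2 * X * (S * th1 c) by ring.
have -> : S * th1 c = - (2 * X) by rewrite -/X -/S in XS; lra.
lra.
Qed.

Lemma diff2_bounded M x y a b : diff2 M x y a b -> exists2 d, 0 < d &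
  exists B : R, forall s t, `|s - x| <= d -> `|t - y| <= d -> `|M s t| <= B.
Proof.
move=> /(_ _ ltr01)[d d0 hd]; exists d => //.
exists (`|M x y| + `|a| * d + `|b| * d + (d + d)) => s t sd td.
have := hd s t sd td; rewrite mul1r => h.
rewrite -[M s t](subrK (M x y + a * (s - x) + b * (t - y))).
apply: le_trans (ler_normD _ _) _; rewrite addrC lerD//; last first.
  by apply: le_trans h _; exact: lerD.
apply: le_trans (ler_normD _ _) _; rewrite lerD ?normrM ?ler_wpM2l//.
by apply: le_trans (ler_normD _ _) _; rewrite lerD ?normrM ?ler_wpM2l.
Qed.

Lemma derive_lipschitz (F f : R -> R) x d (B : R) :
  (forall s, is_derive s 1 F (f s)) ->
  (forall s, `|s - x| <= d -> `|f s| <= B) ->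
  forall s, `|s - x| <= d -> `|F s - F x| <= B * `|s - x|.
Proof.
move=> dF fB s sd; have sdd := sd; move: sdd; rewrite ler_norml => /andP[s1 s2].
have [xs|sx] := leP x s.
  rewrite (@ger0_norm _ (s - x)); last by lra.
  apply: (@derive_le_dist _ F f _ _ B xs) => t.
  rewrite in_itv/= => /andP[? ?]; apply: fB; rewrite ler_norml.
  by apply/andP; split; lra.
rewrite distrC (distrC s) (@ger0_norm _ (x - s)); last by lra.
apply: (@derive_le_dist _ F f _ _ B (ltW sx)) => t.
rewrite in_itv/= => /andP[? ?]; apply: fB; rewrite ler_norml.
by apply/andP; split; lra.
Qed.

(** Both partial derivatives of [G] are locally bounded, so [G] is locally Lipschitz in each
    variable with uniform constants. Joint continuity is what the compactness argument for the
    maxima uses. *)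
Lemma potential_continuous M N G :
  (forall x y, is_derive x 1 (G^~ y) (M x y)) ->
  (forall x y, is_derive y 1 (G x) (N x y)) ->
  (forall x y, exists a b, diff2 M x y a b) ->
  (forall x y, exists a b, diff2 N x y a b) ->
  continuous (fun z : R * R => G z.1 z.2).
Proof.
move=> Gx Gy dM dN -[x y].
have [a [b /diff2_bounded[d1 d10 [B1 hM]]]] := dM x y.
have [a' [b' /diff2_bounded[d2 d20 [B2 hN]]]] := dN x y.
apply/cvgrPdist_le => e e0.
have B10 : 0 <= B1.
  by apply: le_trans (normr_ge0 _) (hM x y _ _); rewrite subrr normr0 ltW.
have B20 : 0 <= B2.
  by apply: le_trans (normr_ge0 _) (hN x y _ _); rewrite subrr normr0 ltW.
pose d := Num.min (Num.min d1 d2) (e / (B1 + B2 + 1)).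
have d0 : 0 < d by rewrite !lt_min d10 d20 divr_gt0//; lra.
have [dd1 dd2 de] : [/\ d <= d1, d <= d2 & d <= e / (B1 + B2 + 1)].
  by rewrite !ge_min !lexx !orbT.
exists (ball x d, ball y d); first by split; exact: nbhsx_ballx.
move=> [s t] [/=]; rewrite /ball/= distrC => /ltW sd.
rewrite distrC => /ltW td; rewrite distrC.
rewrite -(subrK (G x t) (G s t)) -addrA.
apply: le_trans (ler_normD _ _) _.
have h1 : `|G s t - G x t| <= B1 * `|s - x|.
  apply: (@derive_lipschitz (G^~ t) (M^~ t) x d B1) => // r rd.
  by apply: hM; [exact: le_trans rd _|exact: le_trans td _].
have h2 : `|G x t - G x y| <= B2 * `|t - y|.
  apply: (@derive_lipschitz (G x) (N x) y d B2) => // r rd.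
  by apply: hN; [rewrite subrr normr0 ltW|exact: le_trans rd _].
have h3 : B1 * `|s - x| <= B1 * d by rewrite ler_wpM2l.
have h4 : B2 * `|t - y| <= B2 * d by rewrite ler_wpM2l.
rewrite ler_pdivlMr in de; last by lra.
rewrite mulrDr mulr1 mulrDr in de; lra.
Qed.

(** * Weighted maximum principle for an antiderivative [U + iV] of [u + iv] *)

Section UniquePotential.
Variables u v U V : R -> R -> R.
Hypothesis duv : forall x y, exists a b, diff2 u x y a (- b) /\ diff2 v x y b a.
Hypothesis Ux : forall x y, is_derive x 1 (U^~ y) (u x y).
Hypothesis Uy : forall x y, is_derive y 1 (U x) (- v x y).
Hypothesis Vx : forall x y, is_derive x 1 (V^~ y) (v x y).
Hypothesis Vy : forall x y, is_derive y 1 (V x) (u x y).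
Hypotheses (U0 : forall x, U x 0 = 0) (V0 : forall x, V x 0 = 0).
Hypotheses (cU : continuous (fun z : R * R => U z.1 z.2))
           (cV : continuous (fun z : R * R => V z.1 z.2)).
Variables x0 y0 : R.
Hypothesis y00 : 0 < y0.

Let S x y := U x y ^+ 2 + V x y ^+ 2.
Let Y := 4 * y0.
Let al := (4 * Y)^-1.
Let be := (2 * Y)^-1.
(* As [be > al], the weight is strictly subharmonic.  It is at least [- y0] at
   [(x0, y0)], but at most [- Y / 2 = - 2 * y0] on the sides of the rectangle
   [[x0 - 2 * Y, x0 + 2 * Y] x [0, Y]] other than the bottom one. *)
Let wt x y := - y - al * (x - x0) ^+ 2 + be * y ^+ 2.

Let Y0 : 0 < Y. Proof. by rewrite mulr_gt0. Qed.

(** Off the zeros of [S = |U + iV|^2] the function [ln S] is harmonic, so [ln S + la * wt] has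
    positive Laplacian and cannot have a local maximum. *)
Let interior_max la x y : 0 < la ->
  x0 - 2 * Y < x < x0 + 2 * Y -> 0 < y < Y ->
  (forall s t, x0 - 2 * Y <= s <= x0 + 2 * Y -> 0 <= t <= Y ->
     S s t * expR (la * wt s t) <= S x y * expR (la * wt x y)) ->
  S x y = 0.
Proof.
move=> la0 hx hy hmax; have [a [b [du dv]]] := duv x y.
have Sx := @weighted_max (U^~ y) (V^~ y) (u^~ y) (v^~ y)
  (fun s => la * wt s y) (fun s => - 2 * la * al * (s - x0)) _ _
  x a b (- 2 * la * al)
  (Ux^~ y) (Vx^~ y) _ (diff2_is_derivel du) (diff2_is_derivel dv) _ hx.
have dUyy : is_derive y 1 (fun t => - v x t) (- a).
  by have := diff2_is_deriver dv => ?; apply: is_deriveN.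
have Sy := @weighted_max (U x) (V x) (fun t => - v x t) (u x)
  (fun t => la * wt x t) (fun t => la * (2 * be * t - 1)) _ _
  y (- a) (- b) (2 * la * be)
  (Uy x) (Vy x) _ dUyy (diff2_is_deriver du) _ hy.
(* Adding the two tests, the terms in [u^2 + v^2] cancel by the Cauchy-Riemann
   equations, which leaves [S^2 * (be - al) <= 0]. *)
have {}Sx : S x y * (2 * (u x y ^+ 2 + v x y ^+ 2 + U x y * a + V x y * b)
     + S x y * (- 2 * la * al)) <= 4 * (U x y * u x y + V x y * v x y) ^+ 2.
  apply: Sx => [s||s /andP[s1 s2]].
  - by rewrite /wt; apply: is_derive_eq; rewrite /GRing.scale/=; ring.
  - by apply: is_derive_eq; rewrite /GRing.scale/=; ring.
  - by apply: hmax; [rewrite !ltW|case/andP: hy => *; rewrite !ltW].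
have {}Sy : S x y *
     (2 * ((- v x y) ^+ 2 + u x y ^+ 2 + U x y * - a + V x y * - b)
     + S x y * (2 * la * be)) <= 4 * (U x y * - v x y + V x y * u x y) ^+ 2.
  apply: Sy => [t||t /andP[t1 t2]].
  - by rewrite /wt; apply: is_derive_eq; rewrite /GRing.scale/=; ring.
  - by apply: is_derive_eq; rewrite /GRing.scale/=; ring.
  - by apply: hmax; [case/andP: hx => *; rewrite !ltW|rewrite !ltW].
have al0 : 0 < al by rewrite invr_gt0 mulr_gt0.
have beE : be = 2 * al by rewrite /be /al; field; rewrite gt_eqF.
have : S x y ^+ 2 * (2 * la * al) <= 0.
  move: Sx Sy; rewrite beE /S; lra.
rewrite pmulr_lle0; last by rewrite !mulr_gt0.
by move=> h; apply/eqP; rewrite -sqrf_eq0 eq_le h sqr_ge0.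
Qed.

(** On the vertical sides the [al] term contributes [- Y]; on the top side the [be] term gives back
    only half of the [Y] lost by [- y]. *)
Let boundary_wt x y : x0 - 2 * Y <= x <= x0 + 2 * Y -> 0 <= y <= Y ->
  [\/ x = x0 - 2 * Y, x = x0 + 2 * Y | y = Y] -> wt x y <= - 2 * y0.
Proof.
move=> hx /andP[y1 y2] xy.
have alY : al * Y = 4^-1 by rewrite /al; field; rewrite gt_eqF.
have beY : be * Y = 2^-1 by rewrite /be; field; rewrite gt_eqF.
have al0 : 0 < al by rewrite invr_gt0 mulr_gt0.
have be0 : 0 < be by rewrite invr_gt0 mulr_gt0.
have bey : be * y ^+ 2 <= 2^-1 * y.
  by rewrite expr2 mulrA ler_wpM2r// -beY ler_wpM2l// ltW.
have alx := mulr_ge0 (ltW al0) (sqr_ge0 (x - x0)).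
have y0E : y0 = Y / 4 by rewrite /Y; field.
have side : (x - x0) ^+ 2 = 4 * Y ^+ 2 -> wt x y <= - 2 * y0.
  move=> h; rewrite /wt h; have -> : al * (4 * Y ^+ 2) = Y.
    by rewrite /al; field; rewrite gt_eqF.
  by move: bey; rewrite y0E; lra.
case: xy => [xE|xE|yE].
- by apply: side; rewrite xE; ring.
- by apply: side; rewrite xE; ring.
- by rewrite /wt; move: bey alx; rewrite yE y0E; lra.
Qed.

(** The weighted maximum lies on a side where [wt <= - 2 * y0], while [wt x0 y0 >= - y0]. Comparing
    the two values bounds [S x0 y0 * expR (la * y0)] by the maximum [B] of [S], which fails for
    large [la] if [S x0 y0 > 0]. *)
Lemma potential_eq0 : U x0 y0 = 0 /\ V x0 y0 = 0.
Proof.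
suff S0 : S x0 y0 = 0.
  move/eqP: S0; rewrite paddr_eq0 ?sqr_ge0// !sqrf_eq0.
  by move=> /andP[/eqP -> /eqP ->].
apply/eqP; rewrite eq_le addr_ge0 ?sqr_ge0// andbT leNgt; apply/negP => S0.
pose K := [set` `[x0 - 2 * Y, x0 + 2 * Y]] `*` [set` `[0, Y]].
have K0 : K !=set0.
  by exists (x0, 0); split; rewrite /= in_itv/= ?lexx; have := Y0; lra.
have cK : compact K by apply: compact_setX; exact: segment_compact.
have inK x y : x0 - 2 * Y <= x <= x0 + 2 * Y -> 0 <= y <= Y -> (x, y) \in K.
  by move=> hx hy; rewrite inE; split; rewrite /= in_itv.
have x0Y : x0 - 2 * Y <= x0 <= x0 + 2 * Y by have := Y0; lra.
have y0Y : 0 <= y0 <= Y by rewrite /Y; have := y00; lra.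
have contD (F G : R * R -> R) : continuous F -> continuous G ->
    continuous (fun z => F z + G z).
  by move=> cF cG z; apply: continuousD; [exact: cF|exact: cG].
have contM (F G : R * R -> R) : continuous F -> continuous G ->
    continuous (fun z => F z * G z).
  by move=> cF cG z; apply: continuousM; [exact: cF|exact: cG].
have contc a : continuous (fun _ : R * R => a) by move=> z; exact: cvg_cst.
have cS : continuous (fun z : R * R => S z.1 z.2).
  exact: (contD _ _ (contM _ _ cU cU) (contM _ _ cV cV)).
have cx : continuous (fun z : R * R => z.1 - x0).
  by apply: (contD (fun z => z.1) (fun=> - x0)) (contc _) => z; exact: cvg_fst.
have cy : continuous (fun z : R * R => z.2) by move=> z; exact: cvg_snd.
have cwt : continuous (fun z : R * R => wt z.1 z.2).
  rewrite (_ : (fun z : R * R => _) = fun z : R * R => (-1) * z.2 +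
    ((- al) * ((z.1 - x0) * (z.1 - x0)) + be * (z.2 * z.2))).
    exact: (contD _ _ (contM _ _ (contc _) cy) (contD _ _
      (contM _ _ (contc _) (contM _ _ cx cx))
      (contM _ _ (contc _) (contM _ _ cy cy)))).
  by apply/funext => z; rewrite /wt; ring.
have cW la : continuous (fun z : R * R => S z.1 z.2 * expR (la * wt z.1 z.2)).
  apply: (contM _ _ cS) => z.
  apply: (@continuous_comp _ _ _ (fun z : R * R => la * wt z.1 z.2) expR z).
    exact: (contM _ _ (contc _) cwt z).
  exact: continuous_expR.
have [[xm ym] _ Sm] := compact_EVT_max K0 cK (continuous_subspaceT cS).
pose B := S xm ym.
have SB x y : x0 - 2 * Y <= x <= x0 + 2 * Y -> 0 <= y <= Y -> S x y <= B.
  by move=> hx hy; apply: (Sm (x, y)); exact: inK.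
have B0 : 0 < B by apply: lt_le_trans S0 _; exact: SB.
(* Chosen so that [S x0 y0 * (1 + la * y0) = S x0 y0 + B > B]. *)
pose la := B / (S x0 y0 * y0).
have la0 : 0 < la by rewrite divr_gt0// mulr_gt0.
have [[x1 y1]] := compact_EVT_max K0 cK (continuous_subspaceT (cW la)).
rewrite inE => -[]; rewrite /= !in_itv/= => x1Y y1Y Wm.
have {}Wm s t : x0 - 2 * Y <= s <= x0 + 2 * Y -> 0 <= t <= Y ->
     S s t * expR (la * wt s t) <= S x1 y1 * expR (la * wt x1 y1).
  by move=> hs ht; apply: (Wm (s, t)); exact: inK.
have S10 : 0 < S x1 y1.
  have := Wm _ _ x0Y y0Y; have := expR_gt0 (la * wt x1 y1) => e0.
  rewrite -(pmulr_lgt0 _ e0); apply: lt_le_trans.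
  by rewrite mulr_gt0// expR_gt0.
(* The bottom side is excluded because [S] vanishes there while [S x1 y1 > 0]. *)
have bdry : [\/ x1 = x0 - 2 * Y, x1 = x0 + 2 * Y | y1 = Y].
  have [?|n1] := eqVneq x1 (x0 - 2 * Y); first exact: Or31.
  have [?|n2] := eqVneq x1 (x0 + 2 * Y); first exact: Or32.
  have [?|n3] := eqVneq y1 Y; first exact: Or33.
  exfalso; have : S x1 y1 = 0; last by move=> h; rewrite h ltxx in S10.
  case/andP: (x1Y) => h1 h2; case/andP: (y1Y) => h3 h4.
  apply: (interior_max la0 _ _ Wm).
    by rewrite !lt_neqAle h1 h2 n2 eq_sym n1.
  rewrite !lt_neqAle h3 h4 n3 !andbT; apply/eqP => y10.
  by rewrite /S -y10 U0 V0 expr0n addr0 ltxx in S10.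
have wt1 := boundary_wt x1Y y1Y bdry.
have wt0 : - y0 <= wt x0 y0.
  rewrite /wt subrr expr0n mulr0 subr0 lerDl mulr_ge0 ?sqr_ge0//.
  by rewrite invr_ge0 mulr_ge0// ltW.
have : S x0 y0 * expR (la * - y0) <= B * expR (la * (- 2 * y0)).
  apply: (@le_trans _ _ (S x0 y0 * expR (la * wt x0 y0))).
    by rewrite ler_pM2l// ler_expR ler_pM2l.
  apply: le_trans (Wm _ _ x0Y y0Y) _.
  apply: ler_pM; [exact: ltW|exact: expR_ge0|exact: SB|].
  by rewrite ler_expR ler_pM2l.
have -> : la * (- 2 * y0) = la * - y0 + la * - y0 by ring.
rewrite expRD mulrA ler_pM2r ?expR_gt0// mulrN expRN.
rewrite ler_pdivlMr ?expR_gt0// => h.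
have := expR_ge1Dx (la * y0); rewrite -(ler_pM2l S0) => /le_trans/(_ h).
have -> : S x0 y0 * (1 + la * y0) = S x0 y0 + B.
  by rewrite /la; field; rewrite !gt_eqF.
by rewrite gerDr leNgt S0.
Qed.

End UniquePotential.

Lemma holomorphic_eq0 u v :
  (forall x y, exists a b, diff2 u x y a (- b) /\ diff2 v x y b a) ->
  (forall x, u x 0 = 0) -> (forall x, v x 0 = 0) ->
  forall x y, 0 < y -> u x y = 0 /\ v x y = 0.
Proof.
move=> duv u0 v0.
have diff2N M x y a b : diff2 M x y a b ->
  diff2 (fun x y => - M x y) x y (- a) (- b).
  move=> dM e /dM[d d0 hd]; exists d => // s t sd td.
  apply: le_trans (hd _ _ sd td); rewrite -normrN le_eqVlt; apply/orP; left.
  by apply/eqP; congr (`|_|); ring.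
have [U [Ux Uy]] : exists G, (forall x y, is_derive x 1 (G^~ y) (u x y)) /\
    (forall x y, is_derive y 1 (G x) (- v x y)).
  apply: closed_form_potential => x y; have [a [b [du dv]]] := duv x y.
  by exists a, (- b), (- a); split=> //; exact: diff2N.
have [V [Vx Vy]] : exists G, (forall x y, is_derive x 1 (G^~ y) (v x y)) /\
    (forall x y, is_derive y 1 (G x) (u x y)).
  apply: closed_form_potential => x y; have [a [b [du dv]]] := duv x y.
  by exists b, a, (- b).
(* On the real axis [U] and [V] have derivatives [u] and [v], which vanish there; subtracting the
   values at the origin therefore makes them zero on the whole axis. *)
pose U' x y := U x y - U 0 0; pose V' x y := V x y - V 0 0.
have dsub (F : R -> R) (c a x : R) : is_derive x 1 F a ->
  is_derive x 1 (fun t => F t - c) a.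
  by move=> ?; apply: is_derive_eq; rewrite subr0.
have cst0 (F : R -> R) (f : R -> R) : (forall x, is_derive x 1 F (f x)) ->
    (forall x, f x = 0) -> forall x, F x - F 0 = 0.
  move=> dF f0 x; apply/eqP; rewrite subr_eq0; apply/eqP.
  by apply: is_derive_0_is_cst => t; rewrite -(f0 t).
have UV0 x y : 0 < y -> U' x y = 0 /\ V' x y = 0.
  apply: (@potential_eq0 u v U' V') => //.
  - by move=> s; apply: (cst0 (U^~ 0) (u^~ 0)).
  - by move=> s; apply: (cst0 (V^~ 0) (v^~ 0)).
  - apply: (@potential_continuous u (fun x y => - v x y)).
    + by move=> s t; have [a [b [du _]]] := duv s t; exists a, (- b).
    + by move=> s t; have [a [b [_ dv]]] := duv s t; exists (- b), (- a);
      exact: diff2N.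
  - apply: (@potential_continuous v u).
    + by move=> s t; have [a [b [_ dv]]] := duv s t; exists b, a.
    + by move=> s t; have [a [b [du _]]] := duv s t; exists a, (- b).
move=> x y y0.
have zero (F : R -> R -> R) (a : R) : is_derive x 1 (F^~ y) a ->
    (forall s, F s y - F 0 0 = 0) -> a = 0.
  move=> dF F0; rewrite -(derive_val (is_derive := dF)).
  rewrite (_ : F^~ y = cst (F 0 0)) ?derive_cst//.
  by apply/funext => s; apply/eqP; rewrite -subr_eq0; apply/eqP; exact: F0.
split; first by apply: (zero U) => // s; have [] := UV0 s y y0.
by apply: (zero V) => // s; have [] := UV0 s y y0.
Qed.

End HolomorphicUniqueness.

(** * Complex derivatives and the exponential *)

Section ComplexDerivative.
Variable R : realType.
Local Notation C := R[i].

Lemma gtc0 (x : R) : (0 < x%:C) = (0 < x).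
Proof. by rewrite -[0]/(0%:C) ltcR. Qed.

Lemma normc_real (x : R) : `|x%:C| = `|x|%:C.
Proof. by rewrite normc_def /= expr0n addr0 sqrtr_sqr. Qed.

Lemma normr_realE (V : normedZmodType C) (a : V) : `|a| = (complex.Re `|a|)%:C.
Proof. by rewrite RRe_real// normr_real. Qed.

Lemma Re_norm_ge0 (V : normedZmodType C) (a : V) : 0 <= complex.Re `|a|.
Proof. by rewrite -ler0c -normr_realE. Qed.

Lemma normc_le_ReIm (z : C) : `|z| <= (`|complex.Re z| + `|complex.Im z|)%:C.
Proof.
have i1 : `|('i : C)| = 1 by rewrite normc_def /= expr0n expr1n add0r sqrtr1.
rewrite [leLHS](_ : _ = `|(complex.Re z)%:C + 'i%C * (complex.Im z)%:C|);
  last first.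
  by rewrite -complexE.
apply: le_trans (ler_normD _ _) _.
by rewrite normrM i1 mul1r !normc_real rmorphD.
Qed.

Lemma normc_ge_Im (z : C) : `|complex.Im z|%:C <= `|z|.
Proof.
by have := normc_ge_Re (z * 'i); rewrite ReiNIm normrN normrM
  [X in _ * X]normc_def /= expr0n expr1n add0r sqrtr1 mulr1.
Qed.

(** Norms and radii over [C] are themselves complex numbers; real [e] and [d] and the absence of a
    quotient make the condition accessible to real estimates. *)
Lemma derivable_complexP (V : normedModType C) (F : C -> V) (z : C) :
  derivable (F : C^o -> V) z 1 <->
  exists D : V, forall e : R, 0 < e -> exists2 d : R, 0 < d &
    forall h : C, `|h| <= d%:C -> `|F (h + z) - F z - h *: D| <= e%:C * `|h|.
Proof.
split.
  move=> /cvg_ex[D] /cvgrPdist_le FD; exists D => e; rewrite -gtc0 => e0.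
  have := FD _ e0; rewrite near_withinE => /nbhs_ballP[d d0 hd].
  have /andP[dR d0'] : (complex.Im d == 0) && (0 < complex.Re d).
    by have := d0; rewrite /= ltcE.
  exists (complex.Re d / 2); first by rewrite divr_gt0.
  move=> h hle; have [->|h0] := eqVneq h 0.
    by rewrite add0r subrr scale0r subrr !normr0 mulr0.
  have := hd h _ h0; rewrite /ball/= sub0r normrN => /(_ _)/wrap[].
    apply: le_lt_trans hle _; rewrite ltcE /= dR ltr_pdivrMr//.
    by rewrite mulr_natr mulr2n ltrDl.
  rewrite /GRing.scale/= mulr1 => H.
  have -> : F (h + z) - F z - h *: D = - (h *: (D - h^-1 *: (F (h + z) - F z))).
    by rewrite scalerBr scalerA divff// scale1r opprB.
  by rewrite normrN normrZ mulrC ler_wpM2r.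
move=> [D FD]; apply/cvg_ex; exists D; apply/cvgrPdist_le => e e0.
have eE : e = (complex.Re e)%:C by rewrite RRe_real// gtr0_real.
have [|d d0 hd] := FD (complex.Re e); first by rewrite -gtc0 -eE.
rewrite near_withinE; apply/nbhs_ballP; exists d%:C; first by rewrite /= gtc0.
move=> h; rewrite /ball/= sub0r normrN => /ltW/hd + h0.
rewrite /GRing.scale/= mulr1 -eE => H.
rewrite -(@ler_pM2r _ `|h|) ?normr_gt0//; apply: le_trans H.
rewrite mulrC -normrZ scalerBr scalerA divff// scale1r -normrN opprB.
by rewrite addrC.
Qed.

Definition cexp (w : C) : C := (expR (complex.Re w))%:C * expi (complex.Im w).

Lemma cexpD (v w : C) : cexp (v + w) = cexp v * cexp w.
Proof.
case: v w => [a b] [c d]; rewrite /cexp /expi /=; simpc.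
apply/eqP; rewrite eq_complex /= expRD cosD sinD.
by apply/andP; split; apply/eqP; ring.
Qed.

Lemma norm_cexp (w : C) : `|cexp w| = (expR (complex.Re w))%:C.
Proof.
rewrite normrM normc_real (ger0_norm (expR_ge0 _)) normc_def /= cos2Dsin2.
by rewrite sqrtr1 mulr1.
Qed.

Lemma cexp_imag (x : R) : cexp ('i * x%:C) = expi x.
Proof.
have -> : 'i * x%:C = 0 +i* x by simpc.
by rewrite /cexp /= expR0 mul1r.
Qed.

Lemma cexp_derive0 (e : R) : 0 < e -> exists2 d : R, 0 < d &
  forall w : C, `|w| <= d%:C -> `|cexp w - 1 - w| <= e%:C * `|w|.
Proof.
(* The errors of the real and imaginary parts add up to at most [r * |x| + 7 * (r * |y|)], hence the
   factor [8]. *)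
move=> e0; have [r [r0 r1 re]] : exists r, [/\ 0 < r, r <= 1 & r <= e / 8].
  exists (Num.min (e / 8) 1).
  by rewrite lt_min !ge_min !lexx orbT; split=> //; apply/andP; split; lra.
have [d1 d10 h1] := is_deriveP_eps (is_derive_expR (0 : R)) r0.
have [d2 d20 h2] := is_deriveP_eps (is_derive_cos (0 : R)) r0.
have [d3 d30 h3] := is_deriveP_eps (is_derive_sin (0 : R)) r0.
pose d := Num.min (Num.min d1 d2) (Num.min d3 r).
have d0 : 0 < d by rewrite !lt_min d10 d20 d30 r0.
have [dd1 dd2 dd3 dr] : [/\ d <= d1, d <= d2, d <= d3 & d <= r].
  by rewrite !ge_min !lexx !orbT.
exists d => // -[x y] wd.
have xw := normc_ge_Re (x +i* y); have yw := normc_ge_Im (x +i* y).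
rewrite /= in xw yw.
have xd : `|x| <= d by rewrite -lecR; exact: le_trans xw wd.
have yd : `|y| <= d by rewrite -lecR; exact: le_trans yw wd.
have {h1} := h1 x; rewrite subr0 expR0 mul1r => /(_ (le_trans xd dd1)) h1.
have {h2} := h2 y; rewrite subr0 cos0 sin0 oppr0 mul0r addr0 =>
  /(_ (le_trans yd dd2)) h2.
have {h3} := h3 y; rewrite subr0 sin0 cos0 mul1r add0r =>
  /(_ (le_trans yd dd3)) h3.
apply: le_trans (normc_le_ReIm _) _.
rewrite (normr_realE (x +i* y)) -rmorphM lecR.
rewrite (normr_realE (x +i* y)) lecR in xw.
rewrite (normr_realE (x +i* y)) lecR in yw.
set W := complex.Re _ in xw yw *.
rewrite /cexp /expi /=; simpc; rewrite /=.
have c1 : `|cos y| <= 1 by rewrite ler_norml cos_le1 cos_geN1.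
have -> : expR x * cos y - 1 - x =
    (expR x - (1 + x)) * cos y + (1 + x) * (cos y - 1) by ring.
rewrite ?subr0; have -> : expR x * sin y - y =
    (expR x - (1 + x) + x) * sin y + (sin y - y) by ring.
have x0 := normr_ge0 x; have y0 := normr_ge0 y.
have A1 : `|(expR x - (1 + x)) * cos y| <= r * `|x|.
  by rewrite normrM -[leRHS]mulr1 ler_pM.
have A2 : `|(1 + x) * (cos y - 1)| <= 2 * (r * `|y|).
  rewrite normrM ler_pM//; apply: le_trans (ler_normD _ _) _.
  by rewrite normr1; lra.
have A3 : `|expR x - (1 + x) + x| <= 2 * r.
  apply: le_trans (ler_normD _ _) _.
  have : r * `|x| <= `|x| by rewrite ler_piMl.
  lra.
have A4 : `|sin y| <= 2 * `|y|.
  rewrite -[sin y](subrK y); apply: le_trans (ler_normD _ _) _.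
  have : r * `|y| <= `|y| by rewrite ler_piMl.
  lra.
have A5 : `|(expR x - (1 + x) + x) * sin y| <= 2 * r * (2 * `|y|).
  by rewrite normrM ler_pM.
have rx : r * `|x| <= e / 8 * W by rewrite ler_pM// ltW.
have ry : r * `|y| <= e / 8 * W by rewrite ler_pM// ltW.
have := ler_normD ((expR x - (1 + x)) * cos y) ((1 + x) * (cos y - 1)).
have := ler_normD ((expR x - (1 + x) + x) * sin y) (sin y - y).
lra.
Qed.

(** By [cexpD] the increment at [z] is [cexp (k * z)] times the increment at [0], so [cexp_derive0]
    suffices. *)
Lemma derivable_cexp_scale (V : normedModType C) (k : C) (v : V) (z : C) :
  derivable ((fun w => cexp (k * w) *: v) : C^o -> V) z 1.
Proof.
apply/derivable_complexP; exists ((k * cexp (k * z)) *: v) => e e0.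
pose B := complex.Re `|cexp (k * z)| * complex.Re `|v|.
pose K := complex.Re `|k|.
have [B0 K0] : 0 <= B /\ 0 <= K.
  by rewrite mulr_ge0 ?Re_norm_ge0.
have [|d d0 hd] := @cexp_derive0 (e / (B * K + 1)).
  by rewrite divr_gt0// ltr_wpDl// mulr_ge0.
exists (d / (K + 1)); first by rewrite divr_gt0// ltr_wpDl.
move=> h hd'.
rewrite -scalerBl scalerA -scalerBl mulrDr cexpD.
have -> : cexp (k * h) * cexp (k * z) - cexp (k * z) - h * (k * cexp (k * z))
   = (cexp (k * h) - 1 - k * h) * cexp (k * z) by ring.
rewrite normrZ normrM -mulrA.
have -> : `|cexp (k * z)| * `|v| = B%:C by rewrite /B rmorphM /= -!normr_realE.
have khd : `|k * h| <= d%:C.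
  rewrite normrM; apply: le_trans (ler_wpM2l (normr_ge0 k) hd') _.
  rewrite (normr_realE k) -rmorphM lecR -/K mulrA ler_pdivrMr ?ltr_wpDl//.
  by rewrite mulrDr mulr1 mulrC lerDl ltW.
apply: le_trans (ler_wpM2r _ (hd _ khd)) _; first by rewrite ler0c.
rewrite normrM (normr_realE k) -/K (normr_realE h) -!rmorphM lecR.
set H := complex.Re _; have H0 : 0 <= H := Re_norm_ge0 h.
have -> : e / (B * K + 1) * (K * H) * B = (e * H) * (B * K / (B * K + 1)).
  by field; rewrite gt_eqF// ltr_wpDl// mulr_ge0.
have BK : 0 < B * K + 1 by rewrite ltr_wpDl// mulr_ge0.
by rewrite ler_piMr ?mulr_ge0 ?(ltW e0)// ler_pdivrMr// mul1r lerDl.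
Qed.

End ComplexDerivative.

(** * The identity theorem for entire functions on the upper half plane *)

Section EntireVanishing.
Variable R : realType.
Local Notation C := R[i].

Lemma entire_real_eq0 (f : C -> C) :
  (forall z : C, derivable (f : C^o -> C^o) z 1) ->
  (forall t : R, f t%:C = 0) ->
  forall z : C, 0 <= complex.Im z -> f z = 0.
Proof.
move=> df f0.
pose u s t := complex.Re (f (s +i* t)); pose v s t := complex.Im (f (s +i* t)).
(* Multiplication by the complex derivative [a +i* b] has the real matrix with rows [(a, - b)] and
   [(b, a)]: these are the Cauchy-Riemann equations. *)
have duv x y : exists a b, diff2 u x y a (- b) /\ diff2 v x y b a.
  have /derivable_complexP[[a b] hD] := df (x +i* y); exists a, b.
  have main e : 0 < e -> exists2 d : R, 0 < d &
      forall s t, `|s - x| <= d -> `|t - y| <= d ->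
      let w := f (s +i* t) - f (x +i* y) - ((s - x) +i* (t - y)) * (a +i* b) in
      `|complex.Re w| <= e * (`|s - x| + `|t - y|) /\
      `|complex.Im w| <= e * (`|s - x| + `|t - y|).
    move=> e0; have [d d0 hd] := hD _ e0; exists (d / 2);
      first by rewrite divr_gt0.
    move=> s t sd td w.
    have hnorm := normc_le_ReIm ((s - x) +i* (t - y)); rewrite /= in hnorm.
    have wle : `|w| <= (e * (`|s - x| + `|t - y|))%:C.
      have := hd ((s - x) +i* (t - y)).
      have -> : ((s - x) +i* (t - y)) + (x +i* y) = s +i* t.
        by apply/eqP; rewrite eq_complex /= !subrK !eqxx.
      move=> /(_ _)/wrap[|H].
        by apply: le_trans hnorm _; rewrite lecR; lra.
      apply: le_trans H _; rewrite rmorphM; apply: ler_wpM2l hnorm.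
      by rewrite ler0c ltW.
    by split; rewrite -lecR; apply: le_trans wle;
      [exact: normc_ge_Re|exact: normc_ge_Im].
  split=> e /main[d d0 hd]; exists d => // s t sd td;
    have [h1 h2] := hd s t sd td.
    rewrite (_ : _ - _ = complex.Re (f (s +i* t) - f (x +i* y)
      - ((s - x) +i* (t - y)) * (a +i* b))) //.
    rewrite /u; case: (f _) => p q; case: (f _) => p' q'; simpc => /=; ring.
  rewrite (_ : _ - _ = complex.Im (f (s +i* t) - f (x +i* y)
    - ((s - x) +i* (t - y)) * (a +i* b))) //.
  rewrite /v; case: (f _) => p q; case: (f _) => p' q'; simpc => /=; ring.
have u0 s : u s 0 = 0 by rewrite /u f0.
have v0 s : v s 0 = 0 by rewrite /v f0.
move=> [x y] /=; rewrite le_eqVlt => /predU1P[<-|y0]; first exact: f0.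
have [] := holomorphic_eq0 duv u0 v0 x y0; rewrite /u /v.
by case: (f _) => p q /= -> ->.
Qed.

End EntireVanishing.

(** * States, and ground states of the trivial dynamics *)

Section States.
Variables (R : realType) (A : cstar_algebra R).
Implicit Types (a b x : A) (psi : A -> R[i]).

Lemma state_le_norm psi x : is_state psi -> `|psi x| <= `|x|.
Proof.
move=> [_ psiZ _ psi1].
have [/eqP|x0] := eqVneq `|x| 0.
  by rewrite normr_eq0 => /eqP ->; rewrite -(scale0r 0) psiZ mul0r !normr0.
have xi0 : 0 < `|x| by rewrite lt_def x0 normr_ge0.
have : `|psi (`|x|^-1 *: x)| <= 1.
  rewrite normr_realE -[1]/(1%:C) lecR -lee_fin -psi1; apply: ereal_sup_ubound.
  exists (`|x|^-1 *: x) => //=.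
  by rewrite normrZ normfV normr_id mulVf.
by rewrite psiZ normrM normfV normr_id mulrC ler_pdivrMr// mul1r.
Qed.

Lemma state0 psi : is_state psi -> psi 0 = 0.
Proof. by move=> [_ psiZ _ _]; rewrite -(scale0r 0) psiZ mul0r. Qed.

Lemma stateB psi x b : is_state psi -> psi (x - b) = psi x - psi b.
Proof. by move=> [psiD psiZ _ _]; rewrite psiD -scaleN1r psiZ mulN1r. Qed.

Lemma state_neq0 psi : is_state psi -> ~ (forall x, psi x = 0).
Proof.
move=> [_ _ _ psi1] psi0; have : ((1 : R)%:E <= 0)%E;
  last by rewrite lee_fin ler10.
rewrite -psi1; apply: ub_ereal_sup => _ [a _ <-].
by rewrite psi0 normr0.
Qed.

Lemma cmul0r x : cmul x 0 = 0.
Proof. by apply: (addrI (cmul x 0)); rewrite -cmulDr !addr0. Qed.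

Lemma cmulBr a x b : cmul a (x - b) = cmul a x - cmul a b.
Proof. by rewrite cmulDr -scaleN1r cmulZr scaleN1r. Qed.

Lemma cadj0 : cadj (0 : A) = 0.
Proof. by apply: (addrI (cadj 0)); rewrite -cadjD !addr0. Qed.

Lemma norm_cadj x : `|cadj x| = `|x|.
Proof.
have le y : `|y| <= `|cadj y|.
  have [->|y0] := eqVneq y 0; first by rewrite normr0.
  have y1 : 0 < `|y| by rewrite normr_gt0.
  by rewrite -(ler_pM2r y1) -expr2 -cstar_norm cmul_norm.
by apply/eqP; rewrite eq_le le andbT -[leRHS]/(`|x|) -{2}(cadjK x) le.
Qed.

Lemma derivable_state_sub psi a (b : A) (F : R[i] -> A) z : is_state psi ->
  derivable (F : R[i]^o -> A) z 1 ->
  derivable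
    ((fun w => psi (cmul a (F w)) - psi (cmul a b)) : R[i]^o -> R[i]^o) z 1.
Proof.
move=> st /derivable_complexP[D hD]; apply/derivable_complexP.
exists (psi (cmul a D)) => e e0.
pose K := complex.Re `|a|; have K0 : 0 <= K := Re_norm_ge0 a.
have [|d d0 hd] := hD (e / (K + 1)); first by rewrite divr_gt0// ltr_wpDl.
exists d => // h /hd H.
have -> : psi (cmul a (F (h + z))) - psi (cmul a b) -
    (psi (cmul a (F z)) - psi (cmul a b)) - h *: psi (cmul a D) =
    psi (cmul a (F (h + z) - F z - h *: D)).
  have [_ psiZ _ _] := st.
  by rewrite !cmulBr !(stateB _ _ st) cmulZr psiZ /GRing.scale/=; ring.
apply: le_trans (state_le_norm _ st) _; apply: le_trans (cmul_norm _ _) _.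
apply: le_trans (ler_wpM2l (normr_ge0 a) H) _.
rewrite (normr_realE a) -/K (normr_realE h) -!rmorphM lecR mulrA.
rewrite ler_wpM2r ?Re_norm_ge0// mulrA ler_pdivrMr ?ltr_wpDl//.
by rewrite mulrDr mulr1 mulrC lerDl ltW.
Qed.

Lemma trivial_dynamics_ground (sigma : R -> A -> A) psi :
  (forall s x, sigma s x = x) -> is_state psi -> is_ground_state sigma psi.
Proof.
move=> sigma1 st; split=> // a b F [entF Fb].
exists (complex.Re `|psi (cmul a b)|) => z z0.
rewrite -normr_realE (_ : psi (cmul a (F z)) = psi (cmul a b))//.
apply/eqP; rewrite -subr_eq0; apply/eqP.
apply: (@entire_real_eq0 R
  (fun w => psi (cmul a (F w)) - psi (cmul a b))) => //.
  by move=> w; exact: derivable_state_sub.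
by move=> t; rewrite Fb sigma1 subrr.
Qed.

End States.

(** * Compact open sets of the infinite-path groupoid *)

Section InfinitePathFacts.
Variables (k : nat) (L : kgraph k).
Implicit Types (x y : ipath L) (m n q r : NN k) (l : L).

Lemma kcomp_inj (a b a' b' : L) : ksrc a = krng b -> ksrc a' = krng b' ->
  kdeg a = kdeg a' -> kdeg b = kdeg b' -> kcomp a b = kcomp a' b' ->
  a = a' /\ b = b'.
Proof.
move=> ab ab' da db e.
have [p [_ up]] := kfactor (kdeg_comp ab).
have := up (a, b) (And4 erefl erefl ab erefl).
have := up (a', b') (And4 (esym da) (esym db) ab' e).
by move=> -> [-> ->].
Qed.

Lemma omega_atE (a : Omega k) :
  a = omega_at (val a).1 (subN (val a).2 (val a).1).
Proof.
by apply: val_inj => /=; rewrite (subNK (valP a)) -surjective_pairing.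
Qed.

Lemma kdeg_omega_at m q : kdeg (omega_at m q) = q.
Proof. exact: addKN. Qed.

Lemma kdeg_ipath x m q : kdeg (x (omega_at m q)) = q.
Proof. by rewrite ipath_deg kdeg_omega_at. Qed.

Lemma ipath_composable x m q r :
  ksrc (x (omega_at m q)) = krng (x (omega_at (m + q) r)).
Proof.
by have [hr hs _] := ipath_functor x; rewrite hr hs; congr (x _).
Qed.

Lemma ipath_comp x m q r :
  x (omega_at m (q + r)) = kcomp (x (omega_at m q)) (x (omega_at (m + q) r)).
Proof.
have [_ _ hc] := ipath_functor x; rewrite -hc; last exact: val_inj.
congr (x _); apply: val_inj => /=; rewrite val_omega_comp /=;
  last exact: val_inj.
by rewrite addrA.
Qed.

Lemma ipath_factor x y m m' q r :
  x (omega_at m (q + r)) = y (omega_at m' (q + r)) ->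
  x (omega_at m q) = y (omega_at m' q) /\
  x (omega_at (m + q) r) = y (omega_at (m' + q) r).
Proof.
rewrite !ipath_comp => /kcomp_inj; apply; rewrite ?kdeg_ipath//;
  exact: ipath_composable.
Qed.

(** Unique factorization, applied twice: an initial segment determines every segment inside it. *)
Lemma ipath_prefix x y m q r :
  x (omega_at 0 (m + q + r)) = y (omega_at 0 (m + q + r)) ->
  x (omega_at m q) = y (omega_at m q).
Proof. by move=> /ipath_factor[/ipath_factor[_]]; rewrite add0r. Qed.

Lemma ipath_shift_at x m n q :
  ipath_shift m x (omega_at n q) = x (omega_at (n + m) q).
Proof. by congr (x _); apply: val_inj => /=; rewrite addrAC. Qed.

Lemma ipath_shift0 x : ipath_shift 0 x = x.
Proof.
by apply: ipath_eq => a; rewrite (omega_atE a) ipath_shift_at addr0.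
Qed.

Lemma ipath_eq_shift x y q : x (omega_at 0 q) = y (omega_at 0 q) ->
  ipath_shift q x = ipath_shift q y -> x = y.
Proof.
move=> e0 es; apply: ipath_eq => a; rewrite (omega_atE a).
set m := _.1; set r := subN _ _.
apply: (@ipath_prefix _ _ _ _ q);
  rewrite addrC [LHS]ipath_comp [RHS]ipath_comp e0 add0r.
congr (kcomp _ _); have := congr1 (fun z : ipath L =>
  z (omega_at 0 (m + r))) es.
by rewrite !ipath_shift_at add0r.
Qed.

Lemma ksrc_ipath x m q : ksrc (x (omega_at m q)) = x (omega_at (m + q) 0).
Proof.
have [_ hs _] := ipath_functor x; rewrite hs; congr (x _).
by apply: val_inj; rewrite /= addr0.
Qed.

Lemma krng_ipath x m q : krng (x (omega_at m q)) = x (omega_at m 0).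
Proof.
have [hr _ _] := ipath_functor x; rewrite hr; congr (x _).
by apply: val_inj; rewrite /= addr0.
Qed.

Lemma ipath_catP l x y :
  ipath_cat l x y <-> y (omega_at 0 (kdeg l)) = l /\ x = ipath_shift (kdeg l) y.
Proof.
split=> [[_ -> <-]//|[yl ->]]; split=> //.
by rewrite /ipath_rng ipath_shift_at add0r -{1}yl ksrc_ipath add0r.
Qed.

Lemma cylinderP (l m : L) (g : groupoid L) : cylinder l m g <->
  [/\ grng g (omega_at 0 (kdeg l)) = l, gsrc g (omega_at 0 (kdeg m)) = m,
      ipath_shift (kdeg l) (grng g) = ipath_shift (kdeg m) (gsrc g)
    & gdeg g = toZZ (kdeg l) - toZZ (kdeg m)].
Proof.
split=> [[x [/ipath_catP[h1 h2] /ipath_catP[h3 h4] dg]]|[h1 h2 h3 dg]].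
  by split; rewrite // -h2.
exists (ipath_shift (kdeg l) (grng g)).
by split=> //; apply/ipath_catP.
Qed.

Lemma toZZ_inj : injective (@toZZ k).
Proof.
by move=> m n /ffunP h; apply/ffunP => i; have := h i; rewrite !ffunE => -[].
Qed.

(** On such a cylinder the range path determines the whole element, so questions about the groupoid
    become questions about infinite paths. *)
Lemma cylinder_srcP (l : L) (g : groupoid L) : cylinder l (ksrc l) g <->
  [/\ grng g (omega_at 0 (kdeg l)) = l, gsrc g = ipath_shift (kdeg l) (grng g)
    & gdeg g = toZZ (kdeg l)].
Proof.
have Z0 : toZZ (0 : NN k) = 0 by apply/ffunP => i; rewrite !ffunE.
split=> [/cylinderP[h1 _]|[h1 h2 h3]].
  by rewrite kdeg_src ipath_shift0 Z0 subr0 => -> ->.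
apply/cylinderP; rewrite kdeg_src Z0 subr0 ipath_shift0; split=> //.
by rewrite h2 ipath_shift_at add0r -{2}h1 ksrc_ipath add0r.
Qed.

Lemma cylinder_open (l m : L) : ksrc l = ksrc m -> open (cylinder l m).
Proof.
move=> lm; exists [set cylinder l m]; last by rewrite bigcup_set1.
move=> _ ->; exists [fset cylinder l m]%fset.
  by move=> A /fset1P ->; rewrite inE; exists (l, m).
by rewrite set_fset1 bigcap_set1.
Qed.

(** The cylinders form a subbase, and a filter is stable under finite intersections. *)
Lemma cvg_cylinder (F : set_system (groupoid L)) (g : groupoid L) : Filter F ->
  (forall l m : L, ksrc l = ksrc m -> cylinder l m g -> F (cylinder l m)) ->
    F --> g.
Proof.
move=> FF Fcyl A; rewrite /= (@nbhsE (groupoid L)).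
move=> [_ [[B sB <-] [C BC Cg] sUBA]].
rewrite nbhs_filterE; apply: filterS sUBA _; apply: (@filterS _ _ _ C).
  by move=> ? ?; exists C.
have /sB [D sD IDeC] := BC; rewrite -IDeC; apply: filter_bigI => E DE.
have := sD _ DE; rewrite inE => -[[l m] /= lm El].
by rewrite -El; apply: Fcyl => //; rewrite El; move: Cg;
  rewrite -IDeC => /(_ _ DE).
Qed.

(* A cylinder around [g] of degree large compared with [l] is either contained
  in
   the given one or disjoint from it. *)
Lemma cylinder_src_closed (l : L) : closed (cylinder l (ksrc l)).
Proof.
rewrite -[X in closed X]setCK closedC openE => g gl.
have [p [q [pq gpq]]] := groupoidP g.
(* Lengthening both witnesses by [kdeg l] makes [mu] long enough to contain a prefix of degree
   [kdeg l]. *)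
pose p' := p + kdeg l; pose q' := q + kdeg l.
pose mu := grng g (omega_at 0 p'); pose nu := gsrc g (omega_at 0 q').
have dmu : kdeg mu = p' by rewrite kdeg_ipath.
have dnu : kdeg nu = q' by rewrite kdeg_ipath.
have gp'q' : ipath_shift p' (grng g) = ipath_shift q' (gsrc g).
  by rewrite /p' /q' !(addrC _ (kdeg l)) -!ipath_shiftD gpq.
have munu : ksrc mu = ksrc nu.
  rewrite !ksrc_ipath !add0r -[p']add0r -[q']add0r -!ipath_shift_at.
  by rewrite gp'q'.
have gmunu : cylinder mu nu g.
  apply/cylinderP; rewrite dmu dnu; split => //.
  by rewrite pq !toZZD opprD addrACA subrr addr0.
apply: filterS (open_nbhs_nbhs (conj (cylinder_open munu) gmunu)).
move=> g' /cylinderP[]; rewrite dmu dnu =>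
  h1 h2 h3 dg' /cylinder_srcP[e1 e2 dg'l].
apply: gl; apply/cylinder_srcP.
(* A common element [g'] forces this relation of degrees. The segments [mu] and [nu], shared by [g]
   and [g'], then show that [g] itself lies in the cylinder of [l]. *)
have degp : p' = q' + kdeg l.
  by apply: toZZ_inj; rewrite toZZD -dg'l dg' addrC subrK.
split.
- rewrite -[RHS]e1; apply: (@ipath_prefix _ _ 0 _ p).
  by rewrite add0r (addrC _ p); exact: esym h1.
- apply: (@ipath_eq_shift _ _ q').
    rewrite -/nu -h2 e2 !ipath_shift_at add0r; apply: (@ipath_prefix _ _ _ _ 0).
    by rewrite addr0 addrC -degp.
  by rewrite ipath_shiftD -degp gp'q'.
- have [_ _ _ ->] := (cylinderP mu nu g).1 gmunu.
  by rewrite dmu dnu -dg' dg'l.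
Qed.

End InfinitePathFacts.

(** * Compactness of cylinders and their indicator functions *)

Section CylinderIndicator.
Variables (R : realType) (k : nat) (L : kgraph k).
Hypothesis hfin : row_finite L.

(** Otherwise the complements of the finitely many fibres would all belong to [F], although their
    intersection misses [D]. *)
Lemma ultra_finite_fiber (T : Type) (S : choiceType) (F : set_system T)
    (phi : T -> S) (D : set T) :
  UltraFilter F -> F D -> finite_set (phi @` D) ->
  exists s, F (D `&` phi @^-1` [set s]).
Proof.
move=> FU FD /finite_fsetP[X XE]; apply: contrapT => /forallNP nF.
have FX : F (\bigcap_(s in [set` X]) ~` (phi @^-1` [set s])).
  apply: filter_bigI => s _.
  have [Fs|//] := in_ultra_setVsetC (phi @^-1` [set s]) FU.
  by exfalso; apply: (nF s); exact: filterI.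
have [t [Dt Xt]] := filter_ex (filterI FD FX).
have : [set` X] (phi t) by rewrite -XE; exists t.
by move=> /Xt; apply.
Qed.

Lemma cylinder_src_compact (l : L) : compact (cylinder l (ksrc l)).
Proof.
rewrite compact_ultra => F FU FZ; set Z := cylinder l (ksrc l) in FZ *.
(* By row-finiteness an ultrafilter pins down the value of the range path on
  each
   morphism of [Omega k]; these values form the limit path. *)
have /choice[xi Fxi] : forall a : Omega k, exists xi, F [set g | grng g a = xi].
  move=> a; set n := (val a).2.
  have v0 : kdeg (krng l) == 0 by rewrite kdeg_rng.
  have fin_n : finite_set ((fun g : groupoid L => grng g (omega_at 0 n)) @` Z).
    apply: sub_finite_set (hfin (exist _ (krng l) v0) n) =>
      _ [g /cylinder_srcP[gl _ _] <-].
    split; last exact: kdeg_ipath.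
    by rewrite /= -[in RHS]gl !krng_ipath.
  have [mu Fmu] := ultra_finite_fiber FU FZ fin_n.
  have [g [_ gmu]] := filter_ex Fmu.
  exists (grng g a); apply: filterS Fmu => h [_ hmu] /=.
  have nE : n = (val a).1 + subN n (val a).1 + 0.
    by rewrite addr0 (subNK (valP a)).
  rewrite (omega_atE a) -/n; apply: (@ipath_prefix _ _ _ _ _ _ 0).
  by rewrite -nE; exact: etrans hmu (esym gmu).
(* Members of a filter meet, so any three values of [xi] are taken by one range path. Three suffice
   for the composition law, hence [xi] inherits functoriality. *)
have witness a b c :
    exists g, [/\ Z g, grng g a = xi a, grng g b = xi b & grng g c = xi c].
  have [g [[Zg ga] [gb gc]]] :=
    filter_ex (filterI (filterI FZ (Fxi a)) (filterI (Fxi b) (Fxi c))).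
  by exists g.
have xi_functor : is_functor xi.
  split=> [a|a|a b ab].
  - have [g [_ <- <- _]] := witness a (krng a) a.
    by have [-> _ _] := ipath_functor (grng g).
  - have [g [_ <- <- _]] := witness a (ksrc a) a.
    by have [_ -> _] := ipath_functor (grng g).
  - have [g [_ <- <- <-]] := witness a b (kcomp a b).
    by have [_ _ ->] := ipath_functor (grng g).
have xi_deg a : kdeg (xi a) = kdeg a.
  by have [g [_ <- _ _]] := witness a a a; exact: ipath_deg.
pose x := IPath xi_functor xi_deg.
have xl : x (omega_at 0 (kdeg l)) = l.
  have [g [/cylinder_srcP[gl _ _] gxi _ _]] :=
    witness (omega_at 0 (kdeg l)) (omega_at 0 0) (omega_at 0 0).
  by rewrite /= -gxi.
have x_rel : groupoid_rel x (toZZ (kdeg l)) (ipath_shift (kdeg l) x).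
  exists (kdeg l), 0; split; last by rewrite ipath_shift0.
  by apply/ffunP => i; rewrite !ffunE subr0.
exists (GroupoidElt x_rel); split; first exact/cylinder_srcP.
apply: cvg_cylinder => l' m' l'm' /cylinderP[/= h1 h2 h3 h4].
apply: filterS (filterI FZ (filterI (Fxi (omega_at 0 (kdeg l')))
  (Fxi (omega_at (kdeg l) (kdeg m'))))).
(* The source of [g] is its range path shifted by [kdeg l], so the source condition concerns the
   segment of the range path that starts at [kdeg l]. *)
move=> g [/cylinder_srcP[gl gs gd] [/= g1 g2]]; apply/cylinderP; split.
- by rewrite g1 -[RHS]h1.
- rewrite gs ipath_shift_at add0r g2 -[RHS]h2; congr (xi _).
  by apply: val_inj; rewrite /= !add0r addrC.
- rewrite gs ipath_shiftD; congr (ipath_shift _ _); apply: toZZ_inj.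
  by rewrite toZZD h4 addrC subrK.
- by rewrite gd.
Qed.

Lemma Cc_cylinder_indic (l : L) :
  Cc (\1_(cylinder l (ksrc l)) : groupoid L -> R[i]).
Proof.
set Z := cylinder l (ksrc l).
have suppE : [set g | (\1_Z g : R[i]) != 0] = Z.
  apply/seteqP; split=> g /=; rewrite indicE.
    by case: (boolP (g \in Z)) => [/set_mem//|_]; rewrite eqxx.
  by move=> /mem_set ->; exact: oner_neq0.
have cZ : closed Z by exact: cylinder_src_closed.
split; last by rewrite suppE -(closure_id Z).1 //; exact: cylinder_src_compact.
move=> g; suff locally_cst : nbhs g [set h | (\1_Z h : R[i]) = \1_Z g].
  move=> A /nbhs_singleton Ag; apply: (@filterS _ (nbhs g) _ _ _ _ locally_cst).
  by move=> h hg; rewrite /= hg.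
have [gZ|gZ] := pselect (Z g).
  have oZ : open Z by apply: cylinder_open; rewrite ksrc_src.
  apply: (@filterS _ (nbhs g) _ _ _ _ (open_nbhs_nbhs (conj oZ gZ))) => h hZ /=.
  by rewrite !indicE !mem_set.
have oZ : open (~` Z) by rewrite openC.
apply: (@filterS _ (nbhs g) _ _ _ _ (open_nbhs_nbhs (conj oZ gZ))) => h hZ /=.
by rewrite !indicE !memNset.
Qed.

End CylinderIndicator.

(** * Ground states *)

Section GroundStates.
Variables (R : realType) (A : cstar_algebra R).
Implicit Types (a b x y : A) (psi : A -> R[i]) (sigma : R -> A -> A).

(** Additivity and a bound, without linearity, so that the conjugate-linear maps sending [x] to
    [psi (cmul a (cadj x))] are covered. *)
Lemma closed_ker (f : A -> R[i]) : (forall x y, f (x - y) = f x - f y) ->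
  (exists2 K : R, 0 <= K & forall x, `|f x| <= K%:C * `|x|) ->
  closed [set x | f x = 0].
Proof.
move=> fB [K K0 fK] x clx /=; apply/eqP; rewrite -normr_eq0;
  apply: contraT => fx0.
pose r := complex.Re `|f x|.
have r0 : 0 < r.
  rewrite lt_def Re_norm_ge0 andbT; apply: contra fx0 => /eqP r0.
  by rewrite normr_realE -/r r0.
have e0 : 0 < r / (K + 1) by rewrite divr_gt0// ltr_wpDl.
have e0' : 0 < (r / (K + 1))%:C by rewrite gtc0.
have [y [fy]] := clx _ (nbhsx_ballx x _ e0').
rewrite -ball_normE /= (normr_realE (x - y)) ltcR ltr_pdivlMr ?ltr_wpDl// => xy.
have := fK (x - y); rewrite fB fy subr0 (normr_realE (f x)) -/r.
rewrite (normr_realE (x - y)) -rmorphM lecR => h.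
have := lt_le_trans xy h; rewrite mulrDr mulr1 mulrC gtrDl.
by rewrite ltNge Re_norm_ge0.
Qed.

Lemma conj_expi (x : R) : (expi x)^*%C = expi (- x).
Proof. by rewrite /expi cosN sinN. Qed.

Lemma ground_state_negative sigma psi a b c : is_ground_state sigma psi ->
  (forall s, sigma s b = expi (s * c) *: b) -> c < 0 -> psi (cmul a b) = 0.
Proof.
(* At [z = iy] the scalar [cexp ('i * c%:C * z)] has modulus [expR (- c * y)], which is unbounded as
   [c < 0]. *)
move=> [st ground] sb c0; pose F z : A := cexp ('i * c%:C * z) *: b.
have ext : analytic_extension sigma b F.
  split=> [z|t]; first exact: derivable_cexp_scale.
  by rewrite /F -mulrA -rmorphM cexp_imag sb mulrC.
have [M hM] := ground a b F ext.
apply/eqP; rewrite -normr_eq0 normr_realE; set p := complex.Re _.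
have p0 : 0 <= p := Re_norm_ge0 _.
have growth (y : R) : 0 <= y -> expR (- c * y) * p <= M.
  move=> y0; have := hM (0 +i* y) y0; have [_ psiZ _ _] := st.
  rewrite cmulZr psiZ normrM norm_cexp (normr_realE (psi _)) -/p -rmorphM lecR.
  rewrite (_ : complex.Re _ = - c * y)//.
  have -> : 'i * c%:C = 0 +i* c by simpc.
  by rewrite /= mul0r sub0r mulNr.
clearbody p; have [->//|p1] := eqVneq p 0.
have {p0 p1} p0 : 0 < p by rewrite lt_def p1.
have M0 : 0 <= M.
  by apply: le_trans (growth 0 (lexx _)); rewrite mulr_ge0 ?expR_ge0 ?ltW.
(* This height makes the exponent [M / p], and [expR (M / p) * p >= p + M > M] contradicts the
   bound. *)
have y0 : 0 <= M / (- c * p).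
  by rewrite divr_ge0// mulr_ge0 ?oppr_ge0 ?(ltW c0) ?(ltW p0).
have := growth _ y0; have -> : - c * (M / (- c * p)) = M / p.
  have [cn pn] : c != 0 /\ p != 0 by rewrite lt_eqF// gt_eqF.
  by field; rewrite pn.
have /(ler_wpM2r (ltW p0)) := expR_ge1Dx (M / p) => h1 h2.
have pn : p != 0 by rewrite gt_eqF.
have := le_trans h1 h2; rewrite mulrDl mul1r divfK//.
by rewrite gerDr leNgt p0.
Qed.

(** * Ground states against the generators [t l] *)

Section TwistedFamily.
Variables (k : nat) (L : kgraph k) (omega : L -> L -> R[i]) (t : L -> A).
Hypothesis homega : is_2cocycle omega.
Hypothesis ht : is_twisted_family omega t.

Definition src_vertex (l : L) : vertex L :=
  exist _ (ksrc l) (introT eqP (kdeg_src l)).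
Definition rng_vertex (l : L) : vertex L :=
  exist _ (krng l) (introT eqP (kdeg_rng l)).

Lemma family_srcK l : cmul (t l) (t (ksrc l)) = t l.
Proof.
have [_ _ tM _ _] := ht; have [_ omega1 _] := homega.
rewrite tM ?krng_src//; have [_ ->] := omega1 l.
by rewrite scale1r kcomp_idr.
Qed.

Lemma family_adj_rngK l : cmul (cadj (t l)) (t (krng l)) = cadj (t l).
Proof.
have [[_ tv] _ tM _ _] := ht; have [_ omega1 _] := homega.
have [tvE _] := tv (rng_vertex l); rewrite /= in tvE.
rewrite -{1}tvE -cadjM tM ?ksrc_rng//; have [-> _] := omega1 l.
by rewrite scale1r kcomp_idl.
Qed.

Lemma state_vanishing psi : is_state psi -> generates (range t) ->
  (forall a (v : vertex L), psi (cmul a (t (val v))) = 0) -> False.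
Proof.
move=> st gen psiv; apply: (state_neq0 st).
have psit a l : psi (cmul a (t l)) = 0.
  by rewrite -family_srcK cmulA; exact: (psiv _ (src_vertex l)).
have psita a l : psi (cmul a (cadj (t l))) = 0.
  by rewrite -family_adj_rngK cmulA; exact: (psiv _ (rng_vertex l)).
have [psiD psiZ _ _] := st.
(* The kernel of [psi] need not be a subalgebra. Imposing vanishing also after left multiplication
   and for adjoints gives a set closed under products and adjoints. *)
pose S := [set x | psi x = 0] `&` [set x | psi (cadj x) = 0] `&`
  \bigcap_(a in setT) [set x | psi (cmul a x) = 0] `&`
  \bigcap_(a in setT) [set x | psi (cmul a (cadj x)) = 0].
have cadjB x y : cadj (x - y) = cadj x - cadj y.
  by rewrite cadjD -scaleN1r cadjZ rmorphN1 scaleN1r.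
have mul_le a x : `|psi (cmul a x)| <= (complex.Re `|a|)%:C * `|x|.
  rewrite -normr_realE; apply: le_trans (state_le_norm _ st) _;
    exact: cmul_norm.
suff ST : S = setT by move=> x; have [[[/= h _] _] _] : S x by rewrite ST.
apply: gen; last first.
  move=> _ [l _ <-]; split; [split; [split|]|] => /=.
  - by rewrite -family_srcK.
  - by rewrite -family_adj_rngK; exact: (psiv _ (rng_vertex l)).
  - by move=> a _; exact: psit.
  - by move=> a _; exact: psita.
split.
- split; last first.
    split; [split; [split|]|] => /=; rewrite ?cadj0 ?(state0 st)//.
      by move=> a _ /=; rewrite cmul0r (state0 st).
    by move=> a _ /=; rewrite cadj0 cmul0r (state0 st).
  apply: closedI; first apply: closedI; first apply: closedI.
  + apply: closed_ker => [x y|]; first exact: stateB.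
    by exists 1 => // x; rewrite mul1r state_le_norm.
  + apply: closed_ker => [x y|]; first by rewrite cadjB (stateB _ _ st).
    by exists 1 => // x; rewrite mul1r -(norm_cadj x) state_le_norm.
  + apply: closed_bigI => a _; apply: closed_ker => [x y|].
      by rewrite cmulBr (stateB _ _ st).
    by exists (complex.Re `|a|); [exact: Re_norm_ge0|exact: mul_le].
  + apply: closed_bigI => a _; apply: closed_ker => [x y|].
      by rewrite cadjB cmulBr (stateB _ _ st).
    exists (complex.Re `|a|); first exact: Re_norm_ge0.
    by move=> x; rewrite -(norm_cadj x).
- move=> x y [[[/= x1 x2] x3] x4] [[[/= y1 y2] y3] y4];
    split; [split; [split|]|] => /=.
  + by rewrite psiD x1 y1 addr0.
  + by rewrite cadjD psiD x2 y2 addr0.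
  + by move=> a _ /=; rewrite cmulDr psiD x3// y3// addr0.
  + by move=> a _ /=; rewrite cadjD cmulDr psiD x4// y4// addr0.
- move=> z x [[[/= x1 x2] x3] x4]; split; [split; [split|]|] => /=.
  + by rewrite psiZ x1 mulr0.
  + by rewrite cadjZ psiZ x2 mulr0.
  + by move=> a _ /=; rewrite cmulZr psiZ x3// mulr0.
  + by move=> a _ /=; rewrite cadjZ cmulZr psiZ x4// mulr0.
- move=> x y [[[/= x1 x2] x3] x4] [[[/= y1 y2] y3] y4];
    split; [split; [split|]|] => /=.
  + exact: y3.
  + by rewrite cadjM; exact: x4.
  + by move=> a _ /=; rewrite cmulA; exact: y3.
  + by move=> a _ /=; rewrite cadjM cmulA; exact: x4.
- move=> x [[[/= x1 x2] x3] x4]; split; [split; [split|]|] => //=.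
  + by rewrite cadjK.
  + by move=> a _ /=; rewrite cadjK; exact: x3.
Qed.

Lemma exists_path_with_source (n : NN k) (v : vertex L) :
  strongly_connected L -> no_sources L ->
  exists2 l : L, kdeg l = n & ksrc l = val v.
Proof.
move=> hconn hsrc; have [l [rl dl]] := hsrc v n.
have [m [rm sm]] := hconn v (src_vertex l); rewrite /= in rm.
have lm : ksrc l = krng m by rewrite rm.
have : kdeg (kcomp l m) = kdeg m + n by rewrite kdeg_comp// dl addrC.
move=> /kfactor[[mu nu] [[/= _ dnu munu e] _]]; exists nu => //.
by rewrite -(ksrc_comp munu) -e ksrc_comp.
Qed.

Lemma no_ground_state sigma psi (w : NN k -> R) (n : NN k) :
  strongly_connected L -> row_finite L -> no_sources L -> generates (range t) ->
  (forall s x, sigma s (cadj x) = cadj (sigma s x)) ->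
  (forall s l, sigma s (t l) = expi (s * w (kdeg l)) *: t l) ->
  w n != 0 -> ~ is_ground_state sigma psi.
Proof.
move=> hconn hfin hsrc gen sadj st wn ground; have [stt _] := ground.
apply: (state_vanishing stt gen) => a v.
have [_ _ _ tE tsum] := ht; have [psiD _ _ _] := stt.
have /orP[wn0|wn0] : (w n < 0) || (0 < w n) by rewrite -neq_lt.
  have [l dl <-] := exists_path_with_source n v hconn hsrc.
  by rewrite -tE cmulA; apply: (ground_state_negative _ ground (st^~ l));
    rewrite dl.
rewrite (tsum v n) (fsbig_finite _ _ (hfin v n))/=.
rewrite big_seq; apply: (big_ind (fun x => psi (cmul a x) = 0)).
- by rewrite cmul0r (state0 stt).
- by move=> x y hx hy; rewrite cmulDr psiD hx hy addr0.
- move=> l; rewrite in_fset_set; last exact: hfin.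
  rewrite inE => -[_ dl]; rewrite cmulA.
  apply: (@ground_state_negative _ _ _ _ (- w n) ground);
    last by rewrite oppr_lt0.
  by move=> s; rewrite sadj st cadjZ conj_expi dl mulrN.
Qed.

End TwistedFamily.
End GroundStates.

(** * The dynamics on the groupoid algebra *)

Section CocycleDynamics.
Variables (R : realType) (k : nat) (L : kgraph k).
Variables (tw : groupoid L -> groupoid L -> R[i]) (CG : cstar_algebra R)
  (iota : (groupoid L -> R[i]) -> CG) (rho : 'I_k -> R) (sigma : R -> CG -> CG).
Hypothesis hCG : is_twisted_groupoid_algebra tw iota.
Hypothesis hsigma : is_cocycle_dynamics iota (path_cocycle rho) sigma.

(** The constant value of [path_cocycle rho] on [cylinder l (ksrc l)] is
    [degree_weight (kdeg l)]. *)
Definition degree_weight (n : NN k) : R := \sum_(i < k) (n i)%:R * ln (rho i).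

Lemma degree_weight_unitN i : degree_weight (unitN i) = ln (rho i).
Proof.
rewrite /degree_weight (bigD1 i)//= big1 => [|j ji].
  by rewrite ffunE eqxx mul1r addr0.
by rewrite ffunE (negbTE ji) mul0r.
Qed.

Lemma cocycle_dynamics_cylinder (hfin : row_finite L) s (l : L) :
  sigma s (iota \1_(cylinder l (ksrc l))) =
  expi (s * degree_weight (kdeg l)) *: iota \1_(cylinder l (ksrc l)).
Proof.
have [[_ iotaZ _ _] _ _] := hCG; have [_ sigmaE] := hsigma.
have cc := Cc_cylinder_indic R hfin l.
rewrite sigmaE// -iotaZ//; congr iota; apply/funext => g; rewrite indicE.
case: (boolP (g \in _)) => [/set_mem/cylinder_srcP[_ _ dg]|_];
  last by rewrite !mulr0.
congr (expi (s * _) * _); apply: eq_bigr => i _.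
by rewrite dg ffunE.
Qed.

(** The fixed points of [sigma s] form a closed set, which contains the dense image of [Cc] because
    the cocycle vanishes. *)
Lemma cocycle_dynamics_trivial s x : (forall i, rho i = 1) -> sigma s x = x.
Proof.
move=> rho1; have [_ dense _] := hCG; have [[homs _ _ _] sigmaE] := hsigma.
have [_ sigma_cont] := homs s.
have : closed ((fun y => sigma s y - y) @^-1` [set 0]).
  apply: preimage_closed.
    by move=> y _; apply: continuousB; [exact: sigma_cont|exact: cvg_id].
  by apply: accessible_closed_set1; apply: hausdorff_accessible;
    exact: norm_hausdorff.
move=> /(_ x) /=; suff clx : closure ((fun y => sigma s y - y) @^-1` [set 0]) x.
  by move=> /(_ clx)/eqP; rewrite subr_eq0 => /eqP.
have : closure (iota @` Cc (L := L)) x by rewrite dense.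
apply: closure_subset => _ [f fc <-] /=; rewrite sigmaE//.
suff -> : (fun g => expi (s * path_cocycle rho g) * f g) = f by rewrite subrr.
apply/funext => g; rewrite /path_cocycle big1 => [|i _];
  last by rewrite rho1 ln1 mulr0.
by rewrite mulr0 /expi cos0 sin0 mul1r.
Qed.

End CocycleDynamics.

Theorem theorem6p14 (R : realType) (k : nat) (L : kgraph k)
  (hconn : strongly_connected L) (hfin : row_finite L) (hsrc : no_sources L)
  (omega : L -> L -> R[i]) (homega : is_2cocycle omega)
  (* the spectral radii, as elements of (0, +oo) *)
  (p : \bar R) (hp : (1 <= p)%E) (rho : 'I_k -> R)
  (hrho : forall i, is_spectral_radius p (vertex_matrix (L := L) i) (rho i))
  (hrho0 : forall i, 0 < rho i)
  (* tau_omega *)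
  (P : set (L * L)) (hP : is_cylinder_partition P)
  (* C*(G; tau_omega), with C_c(G; tau_omega) -> C*(G; tau_omega) *)
  (CG : cstar_algebra R) (iota : (groupoid L -> R[i]) -> CG)
  (hCG : is_twisted_groupoid_algebra (tau P omega) iota)
  (* C*(L; omega), with its generators *)
  (CL : cstar_algebra R) (t : L -> CL)
  (hCL : is_twisted_kgraph_algebra omega t)
  (* the isomorphism C*(L; omega) -> C*(G; tau_omega) *)
  (Phi : CL -> CG) (hPhi : is_star_iso Phi)
  (hPhit : forall l, Phi (t l) = iota (\1_(cylinder l (ksrc l))))
  (* sigma^c on C*(G; tau_omega), and its transport to C*(L; omega) *)
  (sigmaG : R -> CG -> CG)
  (hsigmaG : is_cocycle_dynamics iota (path_cocycle rho) sigmaG)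
  (sigma : R -> CL -> CL)
  (hsigma : forall s a, Phi (sigma s a) = sigmaG s (Phi a)) :
  ((forall i, rho i = 1) ->
     forall psi : CL -> R[i], is_state psi -> is_ground_state sigma psi) /\
  ((exists i, rho i <> 1) ->
     ~ exists psi : CL -> R[i], is_ground_state sigma psi).
Proof.
(* The dynamics is known explicitly only on the groupoid side; injectivity of [Phi] pulls the
   identities back to [CL]. *)
have [[_ PhiZ _ Phiadj] Phibij] := hPhi; have Phi_inj := bij_inj Phibij.
split=> [rho1 psi st|[i rhoi]].
  apply: trivial_dynamics_ground => // s x; apply: Phi_inj.
  by rewrite hsigma; exact: (cocycle_dynamics_trivial hCG hsigmaG).
move=> [psi]; have [ht gen _] := hCL.
have [[homs _ _ _] _] := hsigmaG.
apply: (@no_ground_state _ _ _ _ _ _ homega ht sigma psi (degree_weight rho)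
  (unitN i)) => //.
- move=> s x; apply: Phi_inj; have [[_ _ _ sigmaadj] _] := homs s.
  by rewrite hsigma !Phiadj sigmaadj hsigma.
- move=> s l; apply: Phi_inj; rewrite hsigma PhiZ hPhit.
  exact: (cocycle_dynamics_cylinder hCG hsigmaG).
- rewrite degree_weight_unitN; apply/eqP => /eqP; rewrite ln_eq0//.
  by move/eqP.
Qed.
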